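(* Let $\Phi$ be a homogeneous Poisson point process with intensity $\lambda>0$ on $\mathbb{R}^d$, let $V_o$ be the typical cell, and let $R_o$ be the distance from the nucleus to a uniformly random point in $V_o$. Approximate the cumulative distribution function of $R_o$ by $$F_{R_o}(r)\approx 1-\exp(-\rho_d\lambda\kappa_d r^d),$$ where the correction factor $\rho_d$ is determined by requiring that the $d$-th derivative with respect to $r$ at $r=0$ of $1-\exp(-\rho_d\lambda\kappa_d r^d)$ equals the $d$-th derivative at $r=0$ of the second-order Taylor series approximation $G(r)$ of $F_{R_o}(r)$ (defined in the context). Then $$\rho_d=1+\frac{\mathrm{Var}[\upsilon_d(V_o)]}{\mathbb{E}[\upsilon_d(V_o)]^2}.$$
   Context: Typical cell: $V_o=\{\mathbf{y}\in\mathbb{R}^d : \|\mathbf{y}\|\le\|\mathbf{x}-\mathbf{y}\|\ \ \forall\mathbf{x}\in\Phi\}$, with nucleus the origin $o$; conditionally on $\Phi$, $R_o=\|\mathbf{Y}\|$ with $\mathbf{Y}$ uniform on $V_o$. $\upsilon_d$ is Lebesgue measure on $\mathbb{R}^d$, $\mathcal{B}_r(o)$ is the ball of radius $r$ centered at $o$, and $\kappa_d=\pi^{d/2}/\Gamma(\frac d2+1)$. The exact CDF is $F_{R_o}(r)=\mathbb{E}\big[Z_1/Z_2\big]$ with $Z_1=\upsilon_d(\mathcal{B}_r(o)\cap V_o)$ and $Z_2=\upsilon_d(V_o)$. Its second-order Taylor series approximation $G(r)$ is the expectation of the second-order Taylor polynomial of $(z_1,z_2)\mapsto z_1/z_2$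 around the mean $(\bar z_1,\bar z_2)=(\mathbb{E}[Z_1],\mathbb{E}[Z_2])$, evaluated at $(Z_1,Z_2)$, that is, $$G(r)=\frac{\bar z_1}{\bar z_2}-\frac{\mathrm{Cov}[Z_1,Z_2]}{\bar z_2^2}+\frac{\bar z_1}{\bar z_2^3}\mathrm{Var}[Z_2],\qquad r\ge0.$$ Derivatives at $r=0$ of functions defined for $r\ge 0$ are one-sided (from the right). *)

(* Defs.v *)
From HB Require Import structures.
From mathcomp Require Import all_boot all_order all_algebra.
From mathcomp Require Import all_classical all_reals all_analysis.
From mathcomp Require Import measurable_realfun.

Set Implicit Arguments.
Unset Strict Implicit.
Unset Printing Implicit Defensive.

Import Order.TTheory GRing.Theory Num.Theory.
Import numFieldNormedType.Exports.

Local Open Scope classical_set_scope.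
Local Open Scope ring_scope.

Section EuclideanSpace.
Context {R : realType}.

(* The library norm on row vectors is the sup norm, hence this definition. *)
Definition enorm (d : nat) (x : 'rV[R]_d) : R :=
  Num.sqrt (\sum_(i < d) x 0 i ^+ 2).

Definition ebounded (d : nat) (B : set 'rV[R]_d) : Prop :=
  exists r : R, forall x, B x -> enorm x <= r.

Definition origin_ball (d : nat) (r : R) : set 'rV[R]_d :=
  [set y | enorm y <= r].

Definition borel (d : nat) : set (set 'rV[R]_d) := <<s @open 'rV[R]_d >>.

(* Lebesgue measure on R^d as the d-fold product of the one-dimensional one:
   the unit mass at the only point of R^0, then
   [vol A = \int vol (x-section of A) dx], which is the library's
   [product_measure1] with R^(d+1) read as R x R^d. Only its values on Borel
   sets are meaningful. *)
Fixpoint vol (d : nat) : set 'rV[R]_d -> \bar R :=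
  match d with
  | 0 => fun A => (\1_A 0)%:E
  | n.+1 => fun A =>
      (\int[lebesgue_measure]_x
         vol [set v : 'rV[R]_n | A (row_mx (x%:M : 'rV[R]_1) v)])%E
  end.

Definition Gamma (s : R) : R :=
  \int[lebesgue_measure]_(t in `]0, +oo[) (t `^ (s - 1) * expR (- t)).

Definition kappa (d : nat) : R :=
  pi `^ (d%:R / 2) / Gamma (d%:R / 2 + 1).

End EuclideanSpace.

Section PoissonPointProcess.
Context {R : realType} {d : nat}.
Context {disp : measure_display} {Omega : measurableType disp}.

Definition npoints (Phi : Omega -> set 'rV[R]_d) (B : set 'rV[R]_d)
  (w : Omega) : \bar R := counting (Phi w `&` B).

(* A homogeneous Poisson point process, as a random locally finite set. The
   Poisson weights are written out because the library's [poisson_pmf] is the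
   constant 1 at rate 0, whereas null sets must carry no points here. The
   counts being integer-valued, factorization of their joint weights over every
   finite disjoint family is their mutual independence. *)
Record poisson_point_process (P : probability Omega R) (lambda : R)
    (Phi : Omega -> set 'rV[R]_d) : Prop := PoissonPointProcess {
  ppp_locally_finite : forall w B, ebounded B -> finite_set (Phi w `&` B) ;
  ppp_measurable : forall B, borel B -> ebounded B ->
    measurable_fun [set: Omega] (npoints Phi B) ;
  ppp_poisson : forall (B : set 'rV[R]_d) (k : nat), borel B -> ebounded B ->
    let m := lambda * fine (vol B) in
    P [set w | npoints Phi B w = k%:R%:E] =
      (m ^+ k / k`!%:R * expR (- m))%:E ;
  ppp_independent : forall (n : nat) (B : 'I_n -> set 'rV[R]_d)
      (k : 'I_n -> nat),
    (forall i, borel (B i) /\ ebounded (B i)) ->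
    trivIset [set: 'I_n] B ->
    P [set w | forall i, npoints Phi (B i) w = (k i)%:R%:E] =
      (\prod_(i < n) P [set w | npoints Phi (B i) w = (k i)%:R%:E])%E
}.

Definition typical_cell (Phi : Omega -> set 'rV[R]_d) (w : Omega) :
    set 'rV[R]_d :=
  [set y | forall x, Phi w x -> enorm y <= enorm (x - y)].

(* For a Poisson point process the cell is almost surely bounded, so that
   [fine] alters this random variable on a null set only. *)
Definition cell_vol (Phi : Omega -> set 'rV[R]_d) (w : Omega) : R :=
  fine (vol (typical_cell Phi w)).

Definition ball_cell_vol (Phi : Omega -> set 'rV[R]_d) (r : R) (w : Omega) :
    R :=
  fine (vol (origin_ball r `&` typical_cell Phi w)).

(* Expectation of the second-order Taylor polynomial of [z1 / z2] at the mean
   of [(ball_cell_vol Phi r, cell_vol Phi)]. *)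
Definition taylor2_cdf (P : probability Omega R)
    (Phi : Omega -> set 'rV[R]_d) (r : R) : R :=
  let z1 := fine 'E_P[ball_cell_vol Phi r] in
  let z2 := fine 'E_P[cell_vol Phi] in
  z1 / z2 - fine (covariance P (ball_cell_vol Phi r) (cell_vol Phi)) / z2 ^+ 2
  + z1 / z2 ^+ 3 * fine 'V_P[cell_vol Phi].

End PoissonPointProcess.

Section HalfLineDerivative.
Context {R : realType}.
Implicit Types (f : R -> R) (r l : R) (n : nat).

Definition half_line : set R := [set s | 0 <= s].

(* Derivatives of functions on [0, +oo[: one-sided at 0, two-sided at r > 0. *)
Definition half_quotient f r : R -> R := fun s => (f s - f r) / (s - r).

Definition half_derivable f r : Prop :=
  cvg (half_quotient f r @ within half_line r^').

Definition half_derive f r : R :=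
  lim (half_quotient f r @ within half_line r^').

(* [f] is [n] times differentiable at 0 with [n]-th derivative [l]: its
   derivatives of order less than [n] exist on a neighbourhood of 0 in
   [0, +oo[, and the one of order [n - 1] is differentiable at 0. *)
Definition nth_derivative_at0 n f l : Prop :=
  match n with
  | 0 => f 0 = l
  | m.+1 =>
      (\forall r \near within half_line (nbhs 0),
         forall k, (k < m)%N -> half_derivable (iter k half_derive f) r)
      /\ half_quotient (iter m half_derive f) 0 s
           @[s --> within half_line 0^'] --> l
  end.

End HalfLineDerivative.

(* Main.v *)
Require Import Defs.
From HB Require Import structures.
From mathcomp Require Import all_boot all_order all_algebra.
From mathcomp Require Import all_classical all_reals all_analysis.
From mathcomp Require Import measurable_realfun.
From mathcomp Require Import ring lra.
Import Order.TTheory GRing.Theory Num.Theory.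
Import numFieldNormedType.Exports.
Local Open Scope classical_set_scope.
Local Open Scope ring_scope.
Set Implicit Arguments.
Unset Strict Implicit.
Unset Printing Implicit Defensive.

(** Write kappa for the volume of the unit ball, V for the typical cell, t for
    r ^ d, and W for the variance of the volume of V. A point y lies in V
    exactly when no point of the process falls into the open ball of radius |y|
    around y; call this ball the hole of y. So y belongs to V with probability
    exp (- lambda kappa |y|^d), and y and z belong to V together with
    probability exp (- lambda h (y, z)), h (y, z) being the volume of the union
    of the two holes ([prob_cell], [prob_cell2]). By Tonelli, the mean of
    Z2 is the integral of exp (- lambda kappa |y|^d) over the space, which is
    1 / lambda, and

      E[Z1]    = integral over the r-ball of exp (- lambda kappa |y|^d) dy,
      E[Z1 Z2] = integral over (r-ball) x (space) of exp (- lambda h (y, z)).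

    Holes scale with their centres, so dilating the variables by r moves all
    the dependence on r into t:

      E[Z1]    = t * integral over B of exp (- t lambda kappa |y|^d) dy,
      E[Z1 Z2] = t * (t * integral over B x (space) of exp (- t lambda h)),

    with B the unit ball. As t tends to 0 the two factors of t tend to kappa and
    to kappa / lambda: on B x (space), h (y, z) differs from kappa |z|^d by at
    most kappa, and t times the integral of exp (- t lambda kappa |z|^d) equals
    kappa / lambda for every t. The covariance is therefore o(t), and

      G (r) = t * (lambda kappa (1 + lambda^2 W) + o(1)).

    The corresponding factor of t for 1 - exp (- rho lambda kappa t) tends to
    rho lambda kappa. Equating the two d-th derivatives gives
    rho = 1 + lambda^2 W, and lambda^2 = 1 / E[Z2]^2.

    A first-order expansion in t does not by itself provide d - 1 derivatives of
    G near 0 and a d-th one at 0. What does is that the o(1) factors are flat: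
    they are smooth for t > 0, and all their iterates under the Euler operator
    t d/dt tend to 0 with t ([flat]). Flatness survives the substitution
    t = r ^ d, and a function r ^ d (c + flat) has d-th derivative d! c at 0
    ([nth_derivative_at0_flat]). For the integrals above, t d/dt acts on
    t ^ (p + k) times the integral of g ^ k exp (- t g) through the neighbouring
    exponent k + 1, which gives flatness by induction ([flat_laplace_diff]).

    Finally kappa is identified with pi ^ (d / 2) / Gamma (d / 2 + 1) by
    computing the integral of exp (- |x|^2) twice, by iterated integration and
    by layers ([lebesgue_unit_ball]). *)

(** * One-sided derivatives of r ^ d times a flat perturbation *)

Section Flat.
Context {R : realType}.
Implicit Types (f phi psi : R -> R) (c r t : R).

Lemma is_derive1_exprn n r : is_derive r 1 (fun s => s ^+ n) (n%:R * r ^+ n.-1).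
Proof.
by apply: DeriveDef; [exact: exprn_derivable|rewrite exp_derive [LHS]mulr1].
Qed.

Lemma is_derive1_mul f g r a b : is_derive r 1 f a -> is_derive r 1 g b ->
  is_derive r 1 (fun s => f s * g s) (a * g r + f r * b).
Proof.
by move=> fa gb; apply: (is_derive_eq (is_deriveM fa gb)); rewrite addrC mulrC.
Qed.

Lemma within_half_line0 : within half_line (0 : R)^' = (0 : R)^'+.
Proof.
apply/seteqP; split => A hA.
- suff : \forall x \near (0 : R), 0 < x -> A x by [].
  have {}hA : \forall x \near (0 : R), x != 0 -> half_line x -> A x by [].
  by apply: filterS hA => x hx x0; apply: hx; [rewrite gt_eqF|exact: ltW].
- suff : \forall x \near (0 : R), x != 0 -> half_line x -> A x by [].
  have {}hA : \forall x \near (0 : R), 0 < x -> A x by [].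
  apply: filterS hA => x hx xn0 x0; apply: hx.
  by rewrite lt_neqAle eq_sym xn0.
Qed.

Lemma within_half_line_gt0 r : 0 < r -> within half_line r^' = r^'.
Proof.
move=> r0; apply/seteqP; split => A hA.
- suff : \forall x \near r, x != r -> A x by [].
  have {}hA : \forall x \near r, x != r -> half_line x -> A x by [].
  by apply: filterS2 hA (lt_nbhsr r0) => x hx x0 xr; apply: hx => //; exact: ltW.
- suff : \forall x \near r, x != r -> half_line x -> A x by [].
  have {}hA : \forall x \near r, x != r -> A x by [].
  by apply: filterS hA => x hx xr _; exact: hx.
Qed.

Lemma lim_half_line r f l : 0 <= r ->
  f @ within half_line r^' --> l -> lim (f @ within half_line r^') = l.
Proof.
rewrite le_eqVlt => /predU1P[<-|r0].
  by rewrite within_half_line0; exact: cvg_lim.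
by rewrite within_half_line_gt0//; exact: cvg_lim.
Qed.

Lemma half_quotient_gt0 f r l : 0 < r -> is_derive r 1 f l ->
  half_quotient f r @ within half_line r^' --> l.
Proof.
move=> r0 /is_derive1_caratheodory[g [fg gr <-]].
rewrite within_half_line_gt0//.
apply: cvg_trans; last exact: (continuous_withinNx _ _).1 gr.
apply: near_eq_cvg; near=> x.
rewrite /half_quotient fg mulfK// subr_eq0.
by near: x; exact: nbhs_dnbhs_neq.
Unshelve. all: by end_near. Qed.

(** The first [n] iterates of the Euler operator [t d/dt] on [phi] exist on
    ]0, +oo[ and, like [phi] itself, tend to 0 at 0. The iterates are kept as
    witnesses because the next one is always available in closed form, whereas
    ordinary derivatives of [phi] may blow up at 0. *)
Fixpoint flat n phi : Prop :=
  phi t @[t --> 0^'+] --> (0 : R) /\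
  if n is m.+1 then exists2 psi, flat m psi &
    forall t, 0 < t -> is_derive t 1 phi (psi t / t) else True.

Lemma flat_cvg n phi : flat n phi -> phi t @[t --> 0^'+] --> (0 : R).
Proof. by case: n => [|n] []. Qed.

Lemma flatZ n c phi : flat n phi -> flat n (fun t => c * phi t).
Proof.
elim: n phi => [|n IHn] phi [phi0 hphi].
  by split => //; rewrite -[X in _ --> X](mulr0 c); exact: cvgM (cvg_cst _) _.
split; first by rewrite -[X in _ --> X](mulr0 c); exact: cvgM (cvg_cst _) _.
have [psi fpsi dpsi] := hphi; exists (fun t => c * psi t); first exact: IHn.
move=> t t0; have := dpsi _ t0 => dphi.
have := is_deriveZ c dphi.
by rewrite scalerAl.
Qed.

Lemma flatD n phi1 phi2 : flat n phi1 -> flat n phi2 ->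
  flat n (fun t => phi1 t + phi2 t).
Proof.
elim: n phi1 phi2 => [|n IHn] phi1 phi2 [phi10 hphi1] [phi20 hphi2].
  by split => //; rewrite -[X in _ --> X](addr0 0); exact: cvgD.
split; first by rewrite -[X in _ --> X](addr0 0); exact: cvgD.
have [psi1 fpsi1 dpsi1] := hphi1; have [psi2 fpsi2 dpsi2] := hphi2.
exists (fun t => psi1 t + psi2 t); first exact: IHn.
move=> t t0; have d1 := dpsi1 _ t0; have d2 := dpsi2 _ t0.
by rewrite mulrDl; exact: is_deriveD.
Qed.

Lemma flatS n phi : flat n.+1 phi -> flat n phi.
Proof.
elim: n phi => [|n IHn] phi [phi0 [psi fpsi dpsi]] //.
by split => //; exists psi => //; exact: IHn.
Qed.

(** The Euler operator turns the substitution [t = r ^ d] into a multiplication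
    by [d]: [r d/dr (phi (r ^ d)) = d (t d/dt phi) (r ^ d)]. *)
Lemma flat_exprn d n phi : (0 < d)%N -> flat n phi ->
  flat n (fun r => phi (r ^+ d)).
Proof.
move=> d0.
have cvgX psi (l : R) : psi t @[t --> 0^'+] --> l ->
    psi (r ^+ d) @[r --> (0 : R)^'+] --> l.
  apply: cvg_comp => A hA.
  have {}hA : \forall x \near (0 : R), 0 < x -> A x by [].
  suff : \forall x \near (0 : R), 0 < x -> A (x ^+ d) by [].
  have : r ^+ d @[r --> (0 : R)] --> (0 : R).
    have := @exprn_continuous R d 0.
    by rewrite /continuous_at expr0n; case: d d0 => [|d'].
  move=> /(_ _ hA) h; apply: (@filterS _ (nbhs (0 : R)) _ _ _ _ h) => x /= hx x0.
  by apply: hx; rewrite exprn_gt0.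
elim: n phi => [|n IHn] phi [phi0 hphi].
  by split => //; exact: cvgX.
split; first exact: cvgX.
have [psi fpsi dpsi] := hphi.
exists (fun r => d%:R * psi (r ^+ d)); first exact/flatZ/IHn.
move=> r r0.
have dphi : is_derive (r ^+ d) 1 phi (psi (r ^+ d) / r ^+ d).
  by apply: dpsi; rewrite exprn_gt0.
have := @is_derive1_comp R phi (fun r => r ^+ d) r _ _ dphi _.
move=> /(_ _ (is_derive1_exprn d r)) h.
apply: (is_derive_eq h).
case: d d0 {cvgX IHn dphi h fpsi dpsi} => // d' _; rewrite /= exprS.
by field; rewrite lt0r_neq0// expf_neq0// lt0r_neq0.
Qed.

(** One differentiation of [r ^ p (c + phi r)] gives
    [r ^ (p - 1) (p c + p phi r + (r d/dr phi) r)], which has the same shape with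
    one Euler iterate less available; at 0, where [phi] need not be
    differentiable, the remaining power of [r] makes the quotient converge to
    the same formula. After [m] steps the function is [r (m.+1! c + o(1))]. *)
Lemma nth_derivative_at0_flat m c phi f : flat m phi ->
  (forall r, 0 <= r -> f r = r ^+ m.+1 * (c + phi r)) ->
  nth_derivative_at0 m.+1 f (m.+1`!%:R * c).
Proof.
elim: m c phi f => [|m IHm] c phi f fphi fE.
  split; first by near=> r.
  rewrite /= within_half_line0 mul1r.
  have : c + phi s @[s --> 0^'+] --> c.
    rewrite -[X in _ --> X]addr0; apply: cvgD; first exact: cvg_cst.
    exact: flat_cvg fphi.
  apply: cvg_trans; apply: near_eq_cvg; near=> s.
  have s0 : 0 < s by near: s; exact: nbhs_right_gt.
  rewrite /half_quotient fE ?ltW// fE// expr0n/= mul0r !subr0 expr1.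
  by rewrite mulrAC divff ?mul1r// lt0r_neq0.
have [phi0 [psi fpsi dphi]] := fphi.
have cvg_f r : 0 <= r -> half_quotient f r @ within half_line r^' -->
    r ^+ m.+1 * (m.+2%:R * c + (m.+2%:R * phi r + psi r)).
  rewrite le_eqVlt => /predU1P[<-|r0].
    rewrite exprS !mul0r within_half_line0.
    have : s ^+ m.+1 * (c + phi s) @[s --> 0^'+] --> (0 : R).
      rewrite -[X in _ --> X](mul0r (c + 0)); apply: cvgM.
        rewrite -[X in _ --> X](expr0n R m.+1).
        exact/cvg_at_right_filter/exprn_continuous.
      by apply: cvgD; [exact: cvg_cst|].
    apply: cvg_trans; apply: near_eq_cvg; near=> s.
    have s0 : 0 < s by near: s; exact: nbhs_right_gt.
    rewrite /half_quotient fE ?ltW// fE// !expr0n/= mul0r !subr0.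
    by rewrite (exprS s m.+1); field; rewrite lt0r_neq0.
  apply: half_quotient_gt0 => //.
  have h1 := dphi _ r0.
  have h2 := is_derive1_exprn m.+2 r.
  have h3 : is_derive r 1 (fun r => c + phi r) (psi r / r).
    by rewrite -[X in is_derive _ _ _ X]add0r; exact: is_deriveD.
  have h4 := is_derive1_mul h2 h3.
  have fX : \forall s \near r, s ^+ m.+2 * (c + phi s) = f s.
    by near=> s; rewrite fE//; apply: ltW; near: s; exact: lt_nbhsr.
  have {}h4 := near_eq_is_derive fX h4.
  apply: (is_derive_eq h4).
  rewrite /= (exprS r m.+1).
  by field; rewrite lt0r_neq0.
have half_f r : 0 <= r -> half_derive f r =
    r ^+ m.+1 * (m.+2%:R * c + (m.+2%:R * phi r + psi r)).
  by move=> r0; exact: (lim_half_line r0 (cvg_f _ r0)).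
have := IHm (m.+2%:R * c) _ (half_derive f) _ half_f.
rewrite mulrA -natrM mulnC -factS.
case.
  by apply: flatD => //; apply: flatZ; exact: flatS fphi.
move=> near_half cvg_half; split.
  have {}near_half : \forall r \near (0 : R), half_line r ->
      forall k, (k < m)%N -> half_derivable (iter k half_derive (half_derive f)) r.
    exact: near_half.
  suff : \forall r \near (0 : R), half_line r ->
      forall k, (k < m.+1)%N -> half_derivable (iter k half_derive f) r by [].
  apply: filterS near_half => r hr r0 [|k] km; last by rewrite iterSr; exact: hr.
  by apply: cvgP; exact: cvg_f.
by rewrite iterSr.
Unshelve. all: by end_near. Qed.

Lemma nth_derivative_at0_inj n f l1 l2 :
  nth_derivative_at0 n f l1 -> nth_derivative_at0 n f l2 -> l1 = l2.
Proof.
case: n => [<- //|n] [_ h1] [_ h2].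
by rewrite -(lim_half_line _ h1)// (lim_half_line _ h2).
Qed.
End Flat.

Section FlatExp.
Context {R : realType}.
Variable a : R.
Implicit Types (t : R).

Lemma is_derive1_expRM t : is_derive t 1 (fun s => expR (a * s)) (a * expR (a * t)).
Proof.
have h : is_derive t 1 (fun s => a * s) a.
  by apply: is_derive_eq; rewrite [LHS]mulr1.
have := @is_derive1_comp R expR (fun s => a * s) t _ _ (is_derive_expR _) h.
by rewrite mulrC.
Qed.

Lemma flat_expR_pow n k : flat n (fun t => t ^+ k.+1 * expR (a * t)).
Proof.
have cvg0 j : t ^+ j.+1 * expR (a * t) @[t --> (0 : R)^'+] --> (0 : R).
  apply: cvg_at_right_filter.
  have h : is_derive (0 : R) 1 (fun t => t ^+ j.+1 * expR (a * t)) _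
    := is_derive1_mul (is_derive1_exprn j.+1 0) (is_derive1_expRM 0).
  have /derivable1_diffP/differentiable_continuous := @ex_derive _ _ _ _ _ _ _ h.
  by rewrite /prop_for /continuous_at expr0n/= mul0r.
elim: n k => [|n IHn] k; split => //.
exists (fun t => k.+1%:R * (t ^+ k.+1 * expR (a * t)) +
                 a * (t ^+ k.+2 * expR (a * t))).
  by apply: flatD; apply: flatZ; exact: IHn.
move=> t t0; have h := is_derive1_mul (is_derive1_exprn k.+1 t) (is_derive1_expRM t).
apply: (is_derive_eq h).
by rewrite /= !exprS; field; rewrite lt0r_neq0.
Qed.

Lemma flat_expR_sub1 n : flat n (fun t => expR (a * t) - 1).
Proof.
have h t : is_derive t 1 (fun s => expR (a * s) - 1) (a * expR (a * t)).
  have := is_derive1_expRM t => h.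
  by rewrite -[X in is_derive _ _ _ X]subr0; exact: is_deriveB.
have cvg0 : expR (a * t) - 1 @[t --> (0 : R)^'+] --> (0 : R).
  apply: cvg_at_right_filter.
  have /derivable1_diffP/differentiable_continuous := @ex_derive _ _ _ _ _ _ _ (h 0).
  by rewrite /prop_for /continuous_at mulr0 expR0 subrr.
case: n => [|n]; split => //.
exists (fun t => a * (t ^+ 1 * expR (a * t))).
  by apply: flatZ; exact: flat_expR_pow.
move=> t t0; apply: (is_derive_eq (h t)).
by rewrite expr1; field; rewrite lt0r_neq0.
Qed.

(** Up to [flat_expR_sub1], the Euler operator acts on this function as [-1]. *)
Lemma flat_expR_quot n : flat n (fun t => (expR (a * t) - 1) / t - a).
Proof.
have cvg0 : (expR (a * t) - 1) / t - a @[t --> (0 : R)^'+] --> (0 : R).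
  rewrite -[X in _ --> X](subrr a); apply: cvgB; last exact: cvg_cst.
  have := is_derive1_expRM 0; rewrite mulr0 expR0 mulr1.
  move=> /is_derive1_caratheodory[g [fg g0 ga]].
  have : g t @[t --> 0^'+] --> a by rewrite -ga; exact: cvg_at_right_filter.
  apply: cvg_trans; apply: near_eq_cvg; near=> t.
  have /= := fg t; rewrite mulr0 expR0 subr0 => fgt; rewrite fgt mulfK//.
elim: n => [|n IHn]; split => //.
exists (fun t => a * (expR (a * t) - 1) + (- 1) * ((expR (a * t) - 1) / t - a)).
  by apply: flatD; apply: flatZ => //; exact: flat_expR_sub1.
move=> t t0.
have t0' := lt0r_neq0 t0.
have h1 : is_derive t 1 (fun s => expR (a * s) - 1) (a * expR (a * t)).
  have := is_derive1_expRM t => h.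
  by rewrite -[X in is_derive _ _ _ X]subr0; exact: is_deriveB.
have h2 : is_derive t 1 (fun s : R => s^-1) (- t ^- 2).
  have h := is_deriveV (lt0r_neq0 t0 : id t != 0) (is_derive_id t 1).
  by apply: (is_derive_eq h); rewrite [LHS]mulr1.
have h3 := is_derive1_mul h1 h2.
have h4 : is_derive t 1 (fun s => (expR (a * s) - 1) / s - a) _ :=
  is_deriveB h3 (is_derive_cst a t 1).
apply: (is_derive_eq h4).
by rewrite expr2; field.
Unshelve. all: by end_near. Qed.
End FlatExp.

Lemma nth_derivative_at0_expR (R : realType) (m : nat) (a : R) :
  nth_derivative_at0 m.+1 (fun r => 1 - expR (- (a * r ^+ m.+1))) (m.+1`!%:R * a).
Proof.
apply: (@nth_derivative_at0_flat _ m a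
  (fun r => (-1) * ((expR (- a * r ^+ m.+1) - 1) / r ^+ m.+1 - - a))).
  by apply: (flat_exprn (ltn0Sn m) (flatZ (- 1) (flat_expR_quot (- a) m))).
move=> r; rewrite le_eqVlt => /predU1P[<-|r0].
  by rewrite expr0n/= mulr0 oppr0 expR0 subrr mul0r.
have := expf_neq0 m.+1 (lt0r_neq0 r0); move: (r ^+ m.+1) => x x0.
by rewrite (mulNr a); move: (expR _) => e; field.
Qed.

(** * Flatness of Laplace integrals *)

Section ExpBounds.
Context {R : realType}.
Implicit Types (x y s : R).

Lemma expr_le_expR n x : 0 <= x -> x ^+ n <= n`!%:R * expR x.
Proof.
case: n => [|n] x0; first by rewrite expr0 fact0 mul1r -expR0 ler_expR.
have := expR_ge1Dxn n x0; set e := expR x => h.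
have n0 : 0 < n.+1`!%:R :> R by rewrite ltr0n fact_gt0.
have : x ^+ n.+1 / n.+1`!%:R <= e by apply: le_trans h; rewrite lerDr.
by rewrite ler_pdivrMr// mulrC.
Qed.

(** Half of the exponential rate absorbs the power. *)
Lemma expr_expRN_le n s x : 0 < s -> 0 <= x ->
  x ^+ n * expR (- (s * x)) <= n`!%:R / (s / 2) ^+ n * expR (- (s / 2 * x)).
Proof.
move=> s0 x0; have s20 : 0 < s / 2 by rewrite divr_gt0.
have -> : - (s * x) = - (s / 2 * x) + - (s / 2 * x) by lra.
rewrite expRD mulrA ler_wpM2r ?expR_ge0// ler_pdivlMr ?exprn_gt0//.
have := @expr_le_expR n (s / 2 * x) (mulr_ge0 (ltW s20) x0).
rewrite exprMn expRN => h.
by rewrite mulrAC ler_pdivrMr ?expR_gt0// mulrC.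
Qed.

(** The decay in the smaller argument [y] is what makes the difference integrable
    in the comparison of [g] with [g0] below. *)
Lemma expr_expRN_lipschitz n : exists2 c : R, 0 <= c & forall x y, 0 <= y -> y <= x ->
  `|x ^+ n * expR (- x) - y ^+ n * expR (- y)| <= c * (x - y) * expR (- (y / 2)).
Proof.
pose b k : R := k`!%:R / (1 / 2) ^+ k.
have b0 k : 0 <= b k by rewrite /b divr_ge0// exprn_ge0.
(* The two terms bound the two terms of the derivative. *)
exists (n%:R * b n.-1 + b n) => [|x y y0 yx]; first by rewrite addr_ge0// mulr_ge0.
pose f (z : R) : R := z ^+ n * expR (- 1 * z).
have df (z : R) : is_derive z 1 f
    (n%:R * z ^+ n.-1 * expR (- 1 * z) + z ^+ n * (- 1 * expR (- 1 * z))).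
  exact: is_derive1_mul (is_derive1_exprn n z) (is_derive1_expRM (- 1) z).
have cf : {within `[y, x], continuous f}.
  by apply: derivable_within_continuous => z _; exact: @ex_derive _ _ _ _ _ _ _ (df z).
have [z] := MVT_segment yx (fun z _ => df z) cf.
rewrite in_itv/= => /andP[yz zx].
rewrite /f !mulN1r => ->; rewrite normrM (@ger0_norm _ (x - y)) ?subr_ge0//.
rewrite (mulrAC _ (x - y)) ler_wpM2r ?subr_ge0//.
have z0 : 0 <= z := le_trans y0 yz.
have hb k : z ^+ k * expR (- z) <= b k * expR (- (z / 2)).
  have := @expr_expRN_le k 1 z ltr01 z0.
  by rewrite !mul1r [2^-1 * z]mulrC /b mul1r.
have hz : expR (- (z / 2)) <= expR (- (y / 2)).
  by rewrite ler_expR lerN2 ler_wpM2r.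
apply: (le_trans (ler_normD _ _)); rewrite mulrN normrN.
rewrite !ger0_norm ?mulr_ge0 ?exprn_ge0 ?expR_ge0//.
rewrite mulrDl; apply: lerD.
  rewrite -mulrA -[X in _ <= X]mulrA ler_wpM2l//; apply: le_trans (hb _) _.
  by rewrite ler_wpM2l.
by apply: le_trans (hb _) _; rewrite ler_wpM2l.
Qed.
End ExpBounds.

Section Laplace.
Context {R : realType} {d : measure_display} {X : measurableType d}.
Variables (mu : {measure set X -> \bar R}) (D : set X).
Implicit Types (k n : nat) (t : R).
Hypothesis mD : measurable D.

(** Up to sign, the [k]-th derivative in [t] of the Laplace integral of [h]. *)
Definition laplace (h : X -> R) k (t : R) : R :=
  \int[mu]_(x in D) (h x ^+ k * expR (- (t * h x))).

Section finite.
Variables (h : X -> R).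
Hypothesis mh : measurable_fun D h.
Hypothesis h_ge0 : forall x, 0 <= h x.
Hypothesis h_fin : forall t, 0 < t ->
  (\int[mu]_(x in D) (expR (- (t * h x)))%:E < +oo)%E.

Lemma measurable_laplace k t :
  measurable_fun D (fun x => h x ^+ k * expR (- (t * h x))).
Proof.
apply: measurable_funM; first exact: measurable_funX.
by apply: measurableT_comp => //; apply: measurableT_comp => //;
  exact: measurable_funM.
Qed.

Lemma integrable_expRN t : 0 < t ->
  mu.-integrable D (EFin \o (fun x => expR (- (t * h x)))).
Proof.
move=> t0; apply/integrableP; split.
  apply/measurable_EFinP; have := measurable_laplace 0 t.
  by under eq_fun do rewrite expr0 mul1r.
by under eq_integral do rewrite /= ger0_norm ?expR_ge0//; exact: h_fin.
Qed.

Lemma integrable_laplace k t : 0 < t ->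
  mu.-integrable D (EFin \o (fun x => h x ^+ k * expR (- (t * h x)))).
Proof.
move=> t0.
have i2 := @integrableZl _ _ _ mu D mD (k`!%:R / (t / 2) ^+ k) _
  (integrable_expRN (divr_gt0 t0 (ltr0n _ 2))).
apply: (le_integrable mD _ _ i2).
  exact/measurable_EFinP/measurable_laplace.
move=> x Dx /=; rewrite lee_fin ger0_norm ?mulr_ge0 ?exprn_ge0 ?expR_ge0//.
rewrite ger0_norm ?expr_expRN_le//.
by rewrite mulr_ge0 ?expR_ge0// divr_ge0// exprn_ge0// divr_ge0// ltW.
Qed.

Lemma is_derive_laplace k t : 0 < t ->
  is_derive t 1 (laplace h k) (- laplace h k.+1 t).
Proof.
move=> t0.
pose f (s : R) x : R := h x ^+ k * expR (- (s * h x)).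
have df (s : R) x : is_derive s 1 (f ^~ x) (- (h x ^+ k.+1 * expR (- (s * h x)))).
  have h1 := is_derive1_mul (is_derive_cst (h x ^+ k) s 1) (is_derive1_expRM (- h x) s).
  have {}h1 : is_derive s 1 (fun s => h x ^+ k * expR (- h x * s)) _ := h1.
  have fE : f ^~ x = (fun s => h x ^+ k * expR (- h x * s)).
    by apply/funext => u; rewrite /f mulNr (mulrC u).
  by rewrite fE; apply: (is_derive_eq h1);
    rewrite /= !mulNr (mulrC (h x) s) exprS; move: (expR _) => e; ring.
(* On ]t / 2, t + 1[ the derivatives are dominated by their value at t / 2. *)
have t2 : 0 < t / 2 by rewrite divr_gt0.
pose G x := h x ^+ k.+1 * expR (- (t / 2 * h x)).
have It : (`]t / 2, t + 1[%classic : set R) t by rewrite /= in_itv/=; lra.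
have I0 s : (`]t / 2, t + 1[%classic : set R) s -> t / 2 < s.
  by rewrite /= in_itv/= => /andP[].
have h1 s : `]t / 2, t + 1[%classic s -> mu.-integrable D (EFin \o f s).
  by move=> /I0 s0; apply: integrable_laplace; exact: lt_trans s0.
have h2 s x : `]t / 2, t + 1[%classic s -> D x -> derivable (f ^~ x) s 1.
  by move=> _ _; exact: @ex_derive _ _ _ _ _ _ _ (df s x).
have h3 x : 0 <= G x by rewrite mulr_ge0 ?exprn_ge0 ?expR_ge0.
have h4 : mu.-integrable D (EFin \o G) by exact: integrable_laplace.
have d1E s x : partial1of2 f s x = - (h x ^+ k.+1 * expR (- (s * h x))).
  by rewrite partial1of2E; exact: @derive_val _ _ _ _ _ _ _ (df s x).
have h5 s x : `]t / 2, t + 1[%classic s -> D x -> `|partial1of2 f s x| <= G x.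
  move=> /I0 s0 _; rewrite d1E normrN ger0_norm ?mulr_ge0 ?exprn_ge0 ?expR_ge0//.
  by rewrite ler_wpM2l ?exprn_ge0// ler_expR lerN2 ler_wpM2r// ltW.
apply: DeriveDef; first exact: (derivable_under_integral mD It h1 h2 h3 h4 h5).
rewrite -derive1E (differentiation_under_integral mD It h1 h2 h3 h4 h5).
under eq_Rintegral do rewrite d1E -mulN1r.
rewrite RintegralZl// ?mulN1r//.
exact: integrable_laplace.
Qed.

(** The Euler operator on these functions, closed up to raising [j] and [k]. *)
Lemma is_derive_expr_laplace j k t : 0 < t ->
  is_derive t 1 (fun t => t ^+ j * laplace h k t)
   ((j%:R * (t ^+ j * laplace h k t) - t ^+ j.+1 * laplace h k.+1 t) / t).
Proof.
move=> t0; have t0' := lt0r_neq0 t0.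
have h1 := is_derive1_mul (is_derive1_exprn j t) (is_derive_laplace k t0).
apply: (is_derive_eq h1).
by case: j {h1} => [|j]; rewrite /= ?expr1 ?expr0 ?exprS; field.
Qed.
End finite.

(** The integrand [g] is a bounded perturbation of [g0], whose Laplace integral
    grows at most like [t ^- p] at 0. *)
Variables (g0 g : X -> R) (p : nat) (C K : R).
Hypothesis C_ge0 : 0 <= C.
Hypothesis mg0 : measurable_fun D g0.
Hypothesis mg : measurable_fun D g.
Hypothesis g0_ge0 : forall x, 0 <= g0 x.
Hypothesis g_ge0 : forall x, 0 <= g x.
Hypothesis g0_le : forall x, D x -> g0 x <= g x.
Hypothesis g_le : forall x, D x -> g x <= g0 x + C.
Hypothesis g0_int : forall t, 0 < t ->
  (\int[mu]_(x in D) (expR (- (t * g0 x)))%:E <= (K / t ^+ p)%:E)%E.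

Let g0_fin t : 0 < t ->
  (\int[mu]_(x in D) (expR (- (t * g0 x)))%:E < +oo)%E.
Proof. by move=> /g0_int; move/le_lt_trans; apply; rewrite ltry. Qed.

Let g_fin t : 0 < t ->
  (\int[mu]_(x in D) (expR (- (t * g x)))%:E < +oo)%E.
Proof.
move=> t0; apply: le_lt_trans (g0_fin t0).
apply: ge0_le_integral => //.
- apply/measurable_EFinP; have := measurable_laplace mg 0 t.
  by under eq_fun do rewrite expr0 mul1r.
- apply/measurable_EFinP; have := measurable_laplace mg0 0 t.
  by under eq_fun do rewrite expr0 mul1r.
- move=> x Dx; rewrite lee_fin ler_expR lerN2 ler_wpM2l ?g0_le//.
  exact: ltW.
Qed.

Definition laplace_diff k (t : R) :=
  t ^+ (p + k) * laplace g k t - t ^+ (p + k) * laplace g0 k t.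

(** In the variable [t g] the perturbation has size [t C], while the factor
    [t ^ p] compensates the growth of the integral of [exp (- t g0 / 2)]. *)
Lemma laplace_diff_le k : exists c : R, forall t, 0 < t -> `|laplace_diff k t| <= c * t.
Proof.
have [c c0 hc] := @expr_expRN_lipschitz R k.
exists (c * C * (K * 2 ^+ p)) => t t0.
have t2 : 0 < t / 2 by rewrite divr_gt0.
have t0' := ltW t0.
have ig := integrable_laplace mg g_ge0 g_fin k t0.
have ig0 := integrable_laplace mg0 g0_ge0 g0_fin k t0.
have igg0 : mu.-integrable D (EFin \o (fun x =>
    g x ^+ k * expR (- (t * g x)) - g0 x ^+ k * expR (- (t * g0 x)))).
  by rewrite /comp; under eq_fun do rewrite EFinB; exact: integrableB.
rewrite /laplace_diff -mulrBr /laplace -RintegralB// exprD.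
rewrite -[X in `|X|]mulrA.
rewrite normrM ger0_norm ?exprn_ge0// -RintegralZl//.
have i2 : mu.-integrable D (EFin \o
    (fun x => t ^+ k * (g x ^+ k * expR (- (t * g x)) - g0 x ^+ k * expR (- (t * g0 x))))).
  exact: (integrableZl mD (t ^+ k) igg0).
have i3 : mu.-integrable D (EFin \o (fun x => c * C * t * expR (- (t / 2 * g0 x)))).
  exact: (integrableZl mD (c * C * t) (integrable_expRN mg0 g0_fin t2)).
have h : `|\int[mu]_(x in D)
     (t ^+ k * (g x ^+ k * expR (- (t * g x)) - g0 x ^+ k * expR (- (t * g0 x))))|
   <= c * C * t * laplace g0 0 (t / 2).
  apply: le_trans (le_normr_Rintegral mD i2) _.
  rewrite /laplace -RintegralZl//; last first.
    exact: integrable_laplace.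
  apply: le_Rintegral => //.
  - exact: integrable_norm i2.
  - by apply: eq_integrable i3 => // x _ /=; rewrite expr0 mul1r.
  move=> x Dx; rewrite expr0 mul1r mulrBr !mulrA -!exprMn.
  have y0 : 0 <= t * g0 x by exact: mulr_ge0.
  have yx : t * g0 x <= t * g x by rewrite ler_wpM2l// g0_le.
  apply: le_trans (hc _ _ y0 yx) _.
  have -> : t * g0 x / 2 = t / 2 * g0 x by rewrite mulrAC.
  rewrite ler_wpM2r ?expR_ge0// -mulrBr -!mulrA ler_wpM2l// mulrC ler_wpM2r//.
  by rewrite lerBlDl g_le.
have h' : laplace g0 0 (t / 2) <= K / (t / 2) ^+ p.
  rewrite -lee_fin /laplace /Rintegral fineK; last first.
    by apply: integrable_fin_num => //; exact: integrable_laplace.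
  by under eq_integral do rewrite expr0 mul1r; exact: g0_int.
have -> : c * C * (K * 2 ^+ p) * t = t ^+ p * (c * C * t * (K / (t / 2) ^+ p)).
  by rewrite expr_div_n; field; rewrite !expf_neq0// lt0r_neq0.
rewrite ler_wpM2l ?exprn_ge0//; apply: le_trans h _.
by rewrite ler_wpM2l// !mulr_ge0.
Qed.

(** The Euler operator maps the [k]-th difference to a combination of the [k]-th
    and the [k.+1]-st, and all of them vanish at 0. *)
Lemma flat_laplace_diff n k : flat n (laplace_diff k).
Proof.
have cvg0 j : laplace_diff j t @[t --> (0 : R)^'+] --> (0 : R).
  have [c hc] := laplace_diff_le j.
  apply: norm_cvg0; apply: (@squeeze_cvgr _ _ _ _ (cst 0) (fun t => c * t)).
  - by near=> t; rewrite normr_ge0/= hc//; near: t; exact: nbhs_right_gt.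
  - exact: cvg_cst.
  - rewrite -[X in _ --> X](mulr0 c); apply: cvg_at_right_filter.
    by apply: cvgM; [exact: cvg_cst|exact: cvg_id].
elim: n k => [|n IHn] k; split => //.
exists (fun t => (p + k)%:R * laplace_diff k t + (- 1) * laplace_diff k.+1 t).
  by apply: flatD; apply: flatZ; exact: IHn.
move=> t t0.
have h1 := is_derive_expr_laplace mg g_ge0 g_fin (p + k) k t0.
have h2 := is_derive_expr_laplace mg0 g0_ge0 g0_fin (p + k) k t0.
have h3 : is_derive t 1 (laplace_diff k) _ := is_deriveB h1 h2.
apply: (is_derive_eq h3); rewrite /laplace_diff addnS.
by field; exact: lt0r_neq0.
Unshelve. all: by end_near. Qed.
End Laplace.

(** * Borel sets of the Euclidean space *)

Section EuclideanBorel.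
Context {R : realType}.

Definition eucl (n : nat) := g_sigma_algebraType (@open 'rV[R]_n).

Definition rat_cube n (q : 'rV[rat]_n * rat) : set 'rV[R]_n :=
  [set x | forall i, `|ratr (q.1 0 i) - x 0 i| < ratr q.2].

Lemma nbhs_rat_cube n (U : set 'rV[R]_n) (x : 'rV[R]_n) : nbhs x U ->
  exists q, rat_cube q x /\ rat_cube q `<=` U.
Proof.
move=> /nbhs_ballP[e /= e0 eU].
have [s] : exists s : rat, ratr s \in `]0, (e / 2)[.
  by apply: rat_in_itvoo; rewrite divr_gt0.
rewrite in_itv/= => /andP[s0 se].
have hr (i : 'I_n) : exists r : rat, `|ratr r - x 0 i| < ratr s.
  have [r] : exists r : rat, ratr r \in `](x 0 i - ratr s), (x 0 i + ratr s)[.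
    by apply: rat_in_itvoo; lra.
  by rewrite in_itv/= => /andP[h1 h2]; exists r; rewrite ltr_norml; lra.
pose q : 'rV[rat]_n := \row_i projT1 (cid (hr i)).
have hq i : `|ratr (q 0 i) - x 0 i| < ratr s.
  by rewrite mxE; case: cid.
exists (q, s); split => //= y hy; apply: eU; split => // i j.
rewrite ord1 /ball/= -(subrKA (ratr (q 0 j))).
apply: le_lt_trans (ler_normD _ _) _; rewrite distrC.
by have := hq j; have := hy j; lra.
Qed.

Lemma measurable_eucl_coord n (i : 'I_n) :
  measurable_fun [set: eucl n] (fun x : eucl n => (x : 'rV[R]_n) 0 i).
Proof.
apply: (measurability _ (RGenOpens.measurableE R)).
move=> _ [_ [a [b ->] <-]]; rewrite setTI; apply: sub_sigma_algebra.
have /continuousP h := @coord_continuous R 1 n 0 i.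
exact/h/interval_open.
Qed.

Lemma measurable_set_ltr d (X : measurableType d) (f g : X -> R) :
  measurable_fun [set: X] f -> measurable_fun [set: X] g ->
  measurable [set x | f x < g x].
Proof.
move=> mf mg; have := measurable_fun_ltr mf mg measurableT (I : measurable [set true]).
by rewrite setTI.
Qed.

Lemma measurable_set_ler d (X : measurableType d) (f g : X -> R) :
  measurable_fun [set: X] f -> measurable_fun [set: X] g ->
  measurable [set x | f x <= g x].
Proof.
move=> mf mg; have := measurable_fun_ler mf mg measurableT (I : measurable [set true]).
by rewrite setTI.
Qed.

Lemma measurable_rat_cube d (X : measurableType d) n (f : X -> 'rV[R]_n) q :
  (forall i, measurable_fun [set: X] (fun x => f x 0 i)) ->
  measurable (f @^-1` rat_cube q).
Proof.
move=> mf.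
have -> : f @^-1` rat_cube q =
    \bigcap_(i in [set: 'I_n]) [set x | `|ratr (q.1 0 i) - f x 0 i| < ratr q.2].
  by apply/seteqP; split => [x /= h i _|x h i]; exact: h.
apply: fin_bigcap_measurable => //.
move=> i _; apply: measurable_set_ltr => //.
by apply: measurableT_comp => //; exact: measurable_funB.
Qed.

(** Rational cubes form a countable base, so the Borel sets are generated by the
    coordinates. *)
Lemma measurable_euclP d (X : measurableType d) n (f : X -> eucl n) :
  (forall i, measurable_fun [set: X] (fun x => (f x : 'rV[R]_n) 0 i)) ->
  measurable_fun [set: X] f.
Proof.
move=> mf; refine (@measurability _ _ X (eucl n) setT f (@open 'rV[R]_n) erefl _).
move=> _ [U oU <-]; rewrite setTI.
have -> : f @^-1` U = \bigcup_(q in [set q | rat_cube q `<=` U]) (f @^-1` (rat_cube q)).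
  apply/seteqP; split => [x /= Ufx|x [q qU] /qU//].
  by have [q [qx qU]] := nbhs_rat_cube (open_nbhs_nbhs (conj oU Ufx)); exists q.
rewrite bigcup_mkcond; apply: countable_bigcupT_measurable => //.
by move=> q; case: ifPn => _ //; exact: measurable_rat_cube.
Qed.
End EuclideanBorel.

(** * Volume as a sigma-finite measure *)

Section VolMeasure.
Context {R : realType}.
Local Notation leb := (@lebesgue_measure R).

Definition rV_cons n (x : R) (v : 'rV[R]_n) : 'rV[R]_n.+1 :=
  row_mx (x%:M : 'rV[R]_1) v.

Definition rV_behead n (u : 'rV[R]_n.+1) : 'rV[R]_n := \row_j u 0 (lift ord0 j).

Lemma rV_cons0 n x (v : 'rV[R]_n) : rV_cons x v 0 ord0 = x.
Proof.
have -> : rV_cons x v 0 ord0 = row_mx (x%:M : 'rV[R]_1) v 0 (lshift n ord0).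
  by congr (_ _ _); exact/val_inj.
by rewrite row_mxEl mxE eqxx mulr1n.
Qed.

Lemma rV_consS n x (v : 'rV[R]_n) j : rV_cons x v 0 (lift ord0 j) = v 0 j.
Proof.
have -> : rV_cons x v 0 (lift ord0 j) = row_mx (x%:M : 'rV[R]_1) v 0 (rshift 1 j).
  by congr (_ _ _); exact/val_inj.
by rewrite row_mxEr.
Qed.

Lemma rV_cons_behead n x (v : 'rV[R]_n) : rV_behead (rV_cons x v) = v.
Proof. by apply/rowP => j; rewrite mxE rV_consS. Qed.

Definition eucl_cons n (p : measurableTypeR R * @eucl R n) : @eucl R n.+1 :=
  rV_cons p.1 p.2.

Definition eucl_uncons n (u : @eucl R n.+1) : measurableTypeR R * @eucl R n :=
  ((u : 'rV[R]_n.+1) 0 ord0, rV_behead u).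

Lemma measurable_eucl_cons n : measurable_fun [set: _] (@eucl_cons n).
Proof.
apply: measurable_euclP => i; case: (unliftP ord0 i) => [j|] ->.
  under eq_fun do rewrite rV_consS.
  exact: measurableT_comp (measurable_eucl_coord j) measurable_snd.
under eq_fun do rewrite rV_cons0.
exact: measurable_fst.
Qed.

Lemma measurable_eucl_uncons n : measurable_fun [set: _] (@eucl_uncons n).
Proof.
apply/measurable_fun_pairP; split; first exact: measurable_eucl_coord.
apply: measurable_euclP => i; rewrite /=.
under eq_fun do rewrite mxE.
exact: measurable_eucl_coord.
Qed.

(** Packs a measure with a proof of its sigma-finiteness, which Tonelli requires of
    both factors. *)
Lemma measure_sigma_finite d1 (T1 : measurableType d1)
    (mu : {measure set T1 -> \bar R}) : sigma_finite [set: T1] mu ->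
  exists m : {sigma_finite_measure set T1 -> \bar R}, forall A, m A = mu A.
Proof.
move=> smu.
pose H1 := isSFinite.Build _ _ _ _ (sfinite_measure_sigma_finite smu).
pose H2 := isSigmaFinite.Build _ _ _ _ smu.
by exists (HB.pack_for (SigmaFiniteMeasure.type T1 R) (Measure.sort mu) H1 H2).
Qed.

Lemma pushforward_sigma_finite d1 d2 (T1 : measurableType d1) (T2 : measurableType d2)
    (m : {measure set T1 -> \bar R}) (f : T1 -> T2) (g : T2 -> T1) :
  sigma_finite [set: T1] m ->
  measurable_fun [set: T1] f -> measurable_fun [set: T2] g -> cancel f g ->
  exists m' : {sigma_finite_measure set T2 -> \bar R},
    forall A, m' A = pushforward m f A.
Proof.
move=> [F FT Foo] mf mg fK.
have [mu muE] : exists mu : {measure set T2 -> \bar R},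
    forall A, mu A = pushforward m f A.
  by unshelve eexists (pushforward m f : {measure set T2 -> \bar R}).
have [|m' m'E] := @measure_sigma_finite _ _ mu; last first.
  by exists m' => A; rewrite m'E.
exists (fun n => g @^-1` (F n)).
  by rewrite -preimage_bigcup -FT preimage_setT.
move=> n; have [mF mFoo] := Foo n; split.
  by rewrite -[X in measurable X]setTI; exact: mg.
rewrite muE /pushforward.
suff -> : f @^-1` (g @^-1` F n) = F n by [].
by apply/seteqP; split => x /=; rewrite fK.
Qed.

Lemma product_measure_sigma_finite d1 d2 (T1 : measurableType d1) (T2 : measurableType d2)
    (m1 : {sigma_finite_measure set T1 -> \bar R})
    (m2 : {sigma_finite_measure set T2 -> \bar R}) :
  sigma_finite [set: T1 * T2] (m1 \x m2)%E.
Proof.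
have /sigma_finiteP[F [TF ndF Foo]] := sigma_finiteT m1.
have /sigma_finiteP[G [TG ndG Goo]] := sigma_finiteT m2.
exists (fun n => F n `*` G n).
  rewrite -setXTT TF TG; apply/seteqP; split => -[x y] /=.
    move=> [[n _ Fx] [k _ Gy]]; exists (maxn n k) => //; split => /=.
      by move: x Fx; apply/subsetPset/ndF/leq_maxl.
    by move: y Gy; apply/subsetPset/ndG/leq_maxr.
  by move=> [n _ []/= Fx Gy]; split; exists n.
move=> k; have [mF Fk] := Foo k; have [mG Gk] := Goo k.
split; first exact: measurableX.
by rewrite product_measure1E// lte_mul_pinfty// ge0_fin_numE.
Qed.

(** The recursion that defines [vol] is the one of the product measure, read
    through [eucl_cons]; hence the equality also holds on sets that are not
    measurable. *)
Lemma exists_vol_measure n :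
  exists m : {sigma_finite_measure set (@eucl R n) -> \bar R}, forall A, m A = vol A.
Proof.
elim: n => [|n [m mE]].
  by exists (@dirac _ (@eucl R 0) 0 R).
have fK : cancel (@eucl_cons n) (@eucl_uncons n).
  by case=> x v; rewrite /eucl_uncons /eucl_cons /= rV_cons0 rV_cons_behead.
have [mu muE] := pushforward_sigma_finite
  (product_measure_sigma_finite leb m) (@measurable_eucl_cons n)
  (@measurable_eucl_uncons n) fK.
exists mu => A; rewrite muE /pushforward /product_measure1 /=.
apply: eq_integral => x _; rewrite /= mE.
by congr vol; apply/seteqP; split => v /=; rewrite /xsection /= inE.
Qed.

Definition lebesgue_eucl n : {sigma_finite_measure set (@eucl R n) -> \bar R} :=
  projT1 (cid (exists_vol_measure n)).

Lemma lebesgue_euclE n A : lebesgue_eucl n A = vol A.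
Proof. by rewrite /lebesgue_eucl; case: cid. Qed.

Lemma lebesgue_eucl_recl n A :
  lebesgue_eucl n.+1 A =
  (\int[leb]_x lebesgue_eucl n [set v : @eucl R n | A (rV_cons x v)])%E.
Proof.
by rewrite lebesgue_euclE /=; apply: eq_integral => x _; rewrite lebesgue_euclE.
Qed.

Lemma integral_eucl_recl n (f : @eucl R n.+1 -> \bar R) :
  measurable_fun [set: @eucl R n.+1] f -> (forall x, 0 <= f x)%E ->
  (\int[lebesgue_eucl n.+1]_x f x =
   \int[leb]_x \int[lebesgue_eucl n]_v f (rV_cons x v))%E.
Proof.
move=> mf f0.
rewrite (eq_measure_integral (pushforward (leb \x lebesgue_eucl n)%E (@eucl_cons n))).
- exact: measurable_eucl_cons.
- move=> mc; rewrite ge0_integral_pushforward//.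
  rewrite preimage_setT fubini_tonelli1//; last by move=> x; exact: f0.
  exact: (measurableT_comp mf mc).
move=> mc A mA _; apply: etrans (lebesgue_eucl_recl A) _.
apply: eq_integral => x _ /=; congr (lebesgue_eucl n _).
by apply/seteqP; split => v /=; rewrite /xsection /= inE.
Qed.

Lemma measurable_lebesgue_eucl_section n (A : set (@eucl R n.+1)) : measurable A ->
  measurable_fun [set: R]
    (fun x => lebesgue_eucl n [set v : @eucl R n | A (rV_cons x v)]).
Proof.
move=> mA.
have mB : measurable (@eucl_cons n @^-1` A).
  by rewrite -[X in measurable X]setTI; exact: measurable_eucl_cons.
have := measurable_fun_xsection (lebesgue_eucl n) mB.
congr measurable_fun; apply/funext => x /=; congr (lebesgue_eucl n _).
by apply/seteqP; split => v /=; rewrite /xsection /= inE.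
Qed.

Lemma measurable_eucl_section n (A : set (@eucl R n.+1)) x : measurable A ->
  measurable [set v : @eucl R n | A (rV_cons x v)].
Proof.
move=> mA; have mB : measurable (@eucl_cons n @^-1` A).
  by rewrite -[X in measurable X]setTI; exact: measurable_eucl_cons.
have := measurable_xsection x mB.
congr measurable.
by apply/seteqP; split => v /=; rewrite /xsection /= inE.
Qed.

Lemma ge0_integral_affine (r b : R) (f : R -> \bar R) : 0 < r ->
  measurable_fun [set: R] f -> (forall x, 0 <= f x)%E ->
  (\int[leb]_x f (r * x + b)%R = (r^-1)%:E * \int[leb]_x f x)%E.
Proof.
move=> r0 mf f0.
have maff : measurable_fun [set: measurableTypeR R]
    (fun x : measurableTypeR R => r * x + b : measurableTypeR R).
  by apply: measurable_funD => //; exact: measurable_funM.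
have r0' := lt0r_neq0 r0.
pose aff (x : measurableTypeR R) : measurableTypeR R := r * x + b.
have E A : measurable A -> leb A = (r%:E * pushforward leb aff A)%E.
  have [mu muE] : exists mu : {measure set (measurableTypeR R) -> \bar R},
      forall A, mu A = (r%:E * pushforward leb aff A)%E.
    by unshelve eexists (mscale (NngNum (ltW r0)) (pushforward leb aff)).
  move=> mA; rewrite -muE; apply: lebesgue_measure_unique => // X [[x y] /= xy <-].
  rewrite muE /pushforward.
  have -> : aff @^-1` `]x, y] = `](x - b) / r, (y - b) / r]%classic.
    apply/seteqP; split => z; rewrite /= !in_itv/= /aff.
      by rewrite ltr_pdivrMr// ler_pdivlMr// ltrBlDr lerBrDr mulrC.
    by rewrite ltr_pdivrMr// ler_pdivlMr// ltrBlDr lerBrDr mulrC.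
  rewrite !lebesgue_measure_itv/= !lte_fin ltr_pM2r ?invr_gt0// ltrD2r.
  by case: ifPn => _; rewrite ?mule0// -EFinD -EFinM; congr EFin; field.
have -> : (\int[leb]_x f x = r%:E * \int[leb]_x f (r * x + b)%R)%E.
  have maff' : measurable_fun [set: measurableTypeR R] aff by exact: maff.
  rewrite (eq_measure_integral (mscale (NngNum (ltW r0)) (pushforward leb aff))) => //.
    rewrite ge0_integral_mscale//= ge0_integral_pushforward//.
  by move=> A mA _; rewrite [LHS]E.
by rewrite muleA -EFinM mulVf// mul1e.
Qed.

End VolMeasure.

(** * Integration by layers *)

Section LayerCake.
Context {R : realType}.
Local Notation leb := (@lebesgue_measure R).

Lemma integral_expRN_itv (a : R) :
  (\int[leb]_(s in `]a, +oo[) (expR (- s))%:E = (expR (- a))%:E)%E.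
Proof.
rewrite integral_itv_obnd_cbnd; last first.
  by apply/measurable_EFinP/measurable_funTS; apply: measurableT_comp.
pose F (s : R) : R := - expR (- 1 * s).
have df (x : R) : is_derive x 1 F (expR (- x)).
  have h := is_derive1_expRM (- 1) x.
  by apply: (is_derive_eq (is_deriveN h)); rewrite !mulN1r opprK.
have cF : continuous F.
  move=> x.
  by have /derivable1_diffP/differentiable_continuous := @ex_derive _ _ _ _ _ _ _ (df x).
rewrite (@ge0_continuous_FTC2y _ _ F _ 0)//.
- by rewrite /F mulN1r EFinN oppeK add0e.
- apply: continuous_subspaceT => x.
  by apply: continuous_comp; [exact: oppr_continuous|exact: continuous_expR].
- rewrite -oppr0; apply: cvgN.
  under eq_fun do rewrite mulN1r.
  exact: cvgr_expR.
- by apply: cvg_at_right_filter; exact: cF.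
- by move=> x _; rewrite derive1E; exact: (@derive_val _ _ _ _ _ _ _ (df x)).
Qed.

(** Tonelli for [exp (- f x)] written as the integral of [exp (- s)] over
    [s > f x]. *)
Lemma layer_cake_expRN d (X : measurableType d)
    (mu : {sigma_finite_measure set X -> \bar R}) (D : set X) (f : X -> R) :
  measurable D -> measurable_fun [set: X] f -> (forall x, 0 <= f x) ->
  (\int[mu]_(x in D) (expR (- f x))%:E =
   \int[leb]_(s in `]0%R, +oo[) ((expR (- s))%:E * mu (D `&` [set x | (f x < s)%R])))%E.
Proof.
move=> mD mf f0.
pose S := D `*` setT `&` [set p : X * measurableTypeR R | f p.1 < p.2].
pose h (p : X * measurableTypeR R) : \bar R := (\1_S p * expR (- p.2))%:E.
have mS : measurable S.
  apply: measurableI; first exact: measurableX.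
  apply: measurable_set_ltr; last exact: measurable_snd.
  exact: measurableT_comp mf measurable_fst.
have mDs s : measurable (D `&` [set x | f x < s]).
  by apply: measurableI => //; apply: measurable_set_ltr.
have mh : measurable_fun [set: X * measurableTypeR R] h.
  apply/measurable_EFinP; apply: measurable_funM; first exact: measurable_indic.
  by apply: measurableT_comp => //; apply: measurableT_comp => //; exact: measurable_snd.
have h0 p : (0 <= h p)%E by rewrite lee_fin mulr_ge0 ?expR_ge0.
have -> : (\int[mu]_(x in D) (expR (- f x))%:E = \int[mu]_x \int[leb]_s h (x, s))%E.
  rewrite integral_mkcond; apply: eq_integral => x _; rewrite patchE.
  case: ifPn => [xD|xD].
    rewrite -integral_expRN_itv integral_mkcond; apply: eq_integral => s _.
    rewrite patchE /h /= indicE.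
    have -> : ((x, s) \in S) = (s \in `]f x, +oo[%classic).
      by apply/idP/idP; rewrite !inE /S /= in_itv/= andbT;
        [move=> []|move=> ?; split => //; split => //; rewrite inE in xD].
    by case: ifPn => _; rewrite ?mul1r ?mul0r.
  rewrite integral0_eq// => s _; rewrite /h /= indicE memNset ?mul0r//.
  by move: xD; rewrite notin_setE => xD [[Dx _] _]; exact: xD.
rewrite (fubini_tonelli h mh h0) [RHS]integral_mkcond.
apply: eq_integral => s _; rewrite patchE.
transitivity ((expR (- s))%:E * mu (D `&` [set x | (f x < s)%R]))%E.
  transitivity (\int[mu]_x ((expR (- s))%:E * (\1_(D `&` [set x | (f x < s)%R]) x)%:E))%E.
    apply: eq_integral => x _; rewrite /h /= muleC -EFinM !indicE.
    congr ((_ %:R * _)%:E); congr nat_of_bool.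
    by apply/idP/idP; rewrite !inE /S /=; [move=> [[]]|move=> []].
  rewrite ge0_integralZl//.
  - by rewrite integral_indic// setIT.
  - by apply/measurable_EFinP; exact: measurable_indic.
case: ifPn => //; rewrite notin_setE /= in_itv/= andbT => /negP.
rewrite -leNgt => s0.
rewrite (_ : _ `&` _ = set0) ?measure0 ?mule0//.
apply/seteqP; split => // x [_ /= fs].
by have := le_lt_trans (f0 x) (lt_le_trans fs s0); rewrite ltxx.
Qed.

(** The layers of [exp (- x)] on ]0, +oo[ are the intervals ]0, s[. *)
Lemma integral_id_expRN : (\int[leb]_(s in `]0%R, +oo[) (expR (- s) * s)%:E = 1)%E.
Proof.
have mD : measurable (`]0, +oo[ : set (measurableTypeR R)) by exact: measurable_itv.
have := @layer_cake_expRN _ _ leb `]0%R, +oo[%classic (fun x => `|x|) mD.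
rewrite (@eq_integral _ _ _ leb _ (fun s => (expR (- s))%:E)); last first.
  by move=> s; rewrite inE/= in_itv/= andbT => s0; rewrite ger0_norm// ltW.
rewrite integral_expRN_itv oppr0 expR0 => ->//; last exact: measurableT_comp.
apply: eq_integral => s; rewrite inE/= in_itv/= andbT => s0.
rewrite EFinM; congr (_ * _)%E.
rewrite (_ : _ `&` _ = `]0, s[%classic).
  by rewrite lebesgue_measure_itv/= lte_fin s0 oppr0 addr0.
apply/seteqP; split => x /=; rewrite !in_itv/= ?andbT.
  by move=> [x0]; rewrite ger0_norm ?ltW// x0.
by move=> /andP[x0 xs]; rewrite ger0_norm ?ltW.
Qed.
End LayerCake.

(** * Euclidean norm and dilations *)

Section EuclideanNorm.
Context {R : realType}.

Lemma enorm_ge0 n (x : 'rV[R]_n) : 0 <= enorm x.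
Proof. exact: sqrtr_ge0. Qed.

Lemma enormZ n (r : R) (x : 'rV[R]_n) : 0 <= r -> enorm (r *: x) = r * enorm x.
Proof.
move=> r0; rewrite /enorm.
under eq_bigr do rewrite mxE exprMn.
by rewrite -mulr_sumr sqrtrM ?exprn_ge0// sqrtr_sqr ger0_norm.
Qed.

Lemma enorm_sqr n (x : 'rV[R]_n) : enorm x ^+ 2 = \sum_(i < n) x 0 i ^+ 2.
Proof. by rewrite sqr_sqrtr// sumr_ge0// => i _; exact: sqr_ge0. Qed.

Section measurable.
Context d (X : measurableType d) (n : nat).
Implicit Types f g : X -> @eucl R n.

Lemma measurable_fun_eucl_coord f i : measurable_fun [set: X] f ->
  measurable_fun [set: X] (fun x => (f x : 'rV[R]_n) 0 i).
Proof. by move=> mf; exact: measurableT_comp (measurable_eucl_coord i) mf. Qed.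

Lemma measurable_fun_enorm f : measurable_fun [set: X] f ->
  measurable_fun [set: X] (fun x => enorm (f x : 'rV[R]_n)).
Proof.
move=> mf; rewrite /enorm.
apply: measurableT_comp; first exact: continuous_measurable_fun (@sqrt_continuous R).
apply: measurable_sum => i; apply: measurable_funX.
exact: measurable_fun_eucl_coord.
Qed.

Lemma measurable_fun_eucl_sub f g : measurable_fun [set: X] f ->
  measurable_fun [set: X] g ->
  measurable_fun [set: X] (fun x => (f x : 'rV[R]_n) - g x : @eucl R n).
Proof.
move=> mf mg; apply: measurable_euclP => i.
under eq_fun do rewrite !mxE.
by apply: measurable_funB; exact: measurable_fun_eucl_coord.
Qed.

Lemma measurable_fun_eucl_scale (r : R) f : measurable_fun [set: X] f ->
  measurable_fun [set: X] (fun x => r *: (f x : 'rV[R]_n) : @eucl R n).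
Proof.
move=> mf; apply: measurable_euclP => i.
under eq_fun do rewrite !mxE.
by apply: measurable_funM => //; exact: measurable_fun_eucl_coord.
Qed.
End measurable.

Lemma rV_cons_affine n (r x : R) (v : 'rV[R]_n) (b : 'rV[R]_n.+1) :
  r *: rV_cons x v + b = rV_cons (r * x + b 0 ord0) (r *: v + rV_behead b).
Proof.
apply/rowP => i; case: (unliftP ord0 i) => [j|] ->.
  rewrite (rV_consS (r * x + b 0 ord0) (r *: v + rV_behead b)) [LHS]mxE.
  by rewrite [X in X + _ = _]mxE (rV_consS x v) !mxE.
rewrite (rV_cons0 (r * x + b 0 ord0) (r *: v + rV_behead b)) [LHS]mxE.
by rewrite [X in X + _ = _]mxE (rV_cons0 x v).
Qed.

(** One coordinate at a time: sections of an affine preimage are affine preimages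
    of sections, each coordinate contributing a factor [r^-1]. *)
Lemma lebesgue_eucl_affine n (r : R) (b : 'rV[R]_n) (A : set (@eucl R n)) :
  0 < r -> measurable A ->
  lebesgue_eucl n [set v : @eucl R n | A (r *: (v : 'rV[R]_n) + b)] =
  (((r ^+ n)^-1)%:E * lebesgue_eucl n A)%E.
Proof.
move=> r0; elim: n b A => [|n IHn] b A mA.
  rewrite expr0 invr1 mul1e; congr (lebesgue_eucl _ _).
  by apply/seteqP; split => x /=; rewrite (thinmx0 (_ + _)) (thinmx0 x).
rewrite lebesgue_eucl_recl.
pose g x := lebesgue_eucl n [set v : @eucl R n | A (rV_cons x v)].
transitivity (\int[lebesgue_measure]_x (((r ^+ n)^-1)%:E * g (r * x + b 0 ord0)%R))%E.
  apply: eq_integral => x _.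
  rewrite /g -(IHn (rV_behead b)); last exact: measurable_eucl_section.
  by congr (lebesgue_eucl _ _); apply/seteqP; split => v /=; rewrite rV_cons_affine.
have mg : measurable_fun [set: R] g by exact: measurable_lebesgue_eucl_section.
rewrite ge0_integralZl//; last 2 first.
- by apply: measurableT_comp mg _; apply: measurable_funD => //; exact: measurable_funM.
- by rewrite lee_fin invr_ge0 exprn_ge0// ltW.
rewrite ge0_integral_affine// muleA -EFinM -invfM -exprSr.
by rewrite [in RHS]lebesgue_eucl_recl.
Qed.

Lemma ge0_integral_eucl_scale n (r : R) (f : @eucl R n -> \bar R) : 0 < r ->
  measurable_fun [set: @eucl R n] f -> (forall x, 0 <= f x)%E ->
  (\int[lebesgue_eucl n]_x f x =
   (r ^+ n)%:E * \int[lebesgue_eucl n]_x f (r *: (x : 'rV[R]_n))%R)%E.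
Proof.
move=> r0 mf f0; have rn0 : 0 <= r ^+ n by rewrite exprn_ge0// ltW.
pose s (x : @eucl R n) : @eucl R n := r *: (x : 'rV[R]_n).
have ms : measurable_fun [set: @eucl R n] s by exact: measurable_fun_eucl_scale.
rewrite (eq_measure_integral (mscale (NngNum rn0) (pushforward (lebesgue_eucl n) s))) => //.
  by rewrite ge0_integral_mscale//= ge0_integral_pushforward.
move=> A mA _.
change (lebesgue_eucl n A = ((r ^+ n)%:E * lebesgue_eucl n (s @^-1` A))%E).
have -> : s @^-1` A = [set v : @eucl R n | A (r *: (v : 'rV[R]_n) + 0)].
  by apply/seteqP; split => x; rewrite /= addr0.
by rewrite lebesgue_eucl_affine// muleA -EFinM divff ?mul1e// expf_neq0// lt0r_neq0.
Qed.

End EuclideanNorm.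

(** * Volume of the unit ball *)

Section BallVolume.
Context {R : realType}.
Local Notation leb := (@lebesgue_measure R).
Local Notation L := lebesgue_eucl.

Definition open_ball n (y : 'rV[R]_n) (s : R) : set (@eucl R n) :=
  [set x | enorm ((x : 'rV[R]_n) - y) < s].

Lemma measurable_enorm n :
  measurable_fun [set: @eucl R n] (fun x : @eucl R n => enorm (x : 'rV[R]_n)).
Proof. exact: (@measurable_fun_enorm R _ (@eucl R n) n id). Qed.

Lemma measurable_open_ball n (y : 'rV[R]_n) s : measurable (open_ball y s).
Proof.
apply: measurable_set_ltr => //; apply: measurable_fun_enorm.
exact: (@measurable_fun_eucl_sub R _ (@eucl R n) n (fun x => x) (fun=> y)).
Qed.

Local Notation V n := (L n (open_ball (0 : 'rV[R]_n) 1)).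

Lemma lebesgue_open_ball_unit n (y : 'rV[R]_n) s : 0 < s ->
  L n (open_ball y s) = ((s ^+ n)%:E * V n)%E.
Proof.
move=> s0; have is0 : 0 < s^-1 by rewrite invr_gt0.
have mB := measurable_open_ball (0 : 'rV[R]_n) 1.
have := lebesgue_eucl_affine (- (s^-1 *: y)) is0 mB.
rewrite exprVn invrK => <-; congr (L n _).
apply/seteqP; split => x /=; rewrite /open_ball /= subr0 -scalerBr enormZ ?ltW//.
  by rewrite mulrC ltr_pdivrMr// mul1r.
by rewrite mulrC ltr_pdivrMr// mul1r.
Qed.

Lemma measurable_gauss n : measurable_fun [set: @eucl R n]
  (fun x : @eucl R n => (expR (- enorm (x : 'rV[R]_n) ^+ 2))%:E).
Proof.
apply/measurable_EFinP; apply: measurableT_comp => //.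
apply: measurableT_comp => //; apply: measurable_funX.
exact: measurable_enorm.
Qed.

Lemma integral_eucl_gauss n :
  (\int[L n]_x (expR (- enorm (x : 'rV[R]_n) ^+ 2))%:E = (Num.sqrt pi ^+ n)%:E)%E.
Proof.
elim: n => [|n IHn].
  rewrite expr0.
  transitivity (\int[L 0]_(x in [set: @eucl R 0]) (cst 1%E x))%E.
    by apply: eq_integral => x _; rewrite enorm_sqr big_ord0 oppr0 expR0.
  rewrite integral_cst// mul1e; apply: etrans (lebesgue_euclE setT) _.
  by rewrite /= indicT.
rewrite integral_eucl_recl; last 2 first.
- exact: measurable_gauss.
- by move=> x; rewrite lee_fin expR_ge0.
transitivity (\int[leb]_x ((Num.sqrt pi ^+ n)%:E * (gauss_fun x)%:E))%E.
  apply: eq_integral => x _; rewrite -IHn.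
  transitivity (\int[L n]_v ((gauss_fun x)%:E * (expR (- enorm (v : 'rV[R]_n) ^+ 2))%:E))%E.
    apply: eq_integral => v _; rewrite -EFinM -expRD !enorm_sqr big_ord_recl.
    rewrite (rV_cons0 x v) opprD; congr ((expR (_ - _))%:E).
    by apply: eq_bigr => j _; rewrite (rV_consS x v).
  rewrite ge0_integralZl//; first by rewrite muleC.
  - exact: measurable_gauss.
  - by rewrite lee_fin gauss_fun_ge0.
rewrite ge0_integralZl//.
- by rewrite integralT_gauss -EFinM -exprSr.
- by apply/measurable_EFinP; exact: measurable_gauss_fun.
- by move=> x _; rewrite lee_fin gauss_fun_ge0.
Qed.

(** On the ball the Gaussian weight is at least [exp (-1)]. *)
Lemma lebesgue_unit_ball_fin n : (V n < +oo)%E.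
Proof.
have h : ((expR (- 1))%:E * V n <= (Num.sqrt pi ^+ n)%:E)%E.
  rewrite -integral_eucl_gauss -integral_cst; last exact: measurable_open_ball.
  apply: le_trans; last first.
    apply: (@ge0_subset_integral _ _ _ (L n) (open_ball (0 : 'rV[R]_n) 1)) => //.
    - exact: measurable_open_ball.
    - exact: measurable_gauss.
  apply: ge0_le_integral => //.
  - exact: measurable_open_ball.
  - by move=> x _; rewrite lee_fin expR_ge0.
  - by apply: measurable_funTS; exact: measurable_gauss.
  - move=> x; rewrite /open_ball /= subr0 => x1.
    rewrite lee_fin ler_expR lerN2; apply: exprn_ile1; first exact: enorm_ge0.
    exact: ltW.
rewrite ltNge; apply/negP; rewrite leye_eq => /eqP VE; move: h.
by rewrite VE gt0_muley ?lte_fin ?expR_gt0// leye_eq.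
Qed.

(** The Gaussian integral by layers: the set where [|x|^2 < s] is a ball of radius
    [sqrt s]. *)
Lemma unit_ball_Gamma_integral n :
  ((fine (V n))%:E * \int[leb]_(s in `]0%R, +oo[) (s `^ (n%:R / 2 + 1 - 1) * expR (- s))%:E
   = (pi `^ (n%:R / 2))%:E)%E.
Proof.
have VE : (fine (V n))%:E = V n.
  by rewrite fineK// ge0_fin_numE// lebesgue_unit_ball_fin.
have -> : pi `^ (n%:R / 2) = Num.sqrt pi ^+ n :> R.
  by rewrite mulrC powRrM powR12_sqrt ?pi_ge0// powR_mulrn// sqrtr_ge0.
rewrite -integral_eucl_gauss layer_cake_expRN//; last 2 first.
- apply: measurable_funX; exact: measurable_enorm.
- by move=> x; exact: sqr_ge0.
rewrite -ge0_integralZl//; last 3 first.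
- apply/measurable_EFinP/measurable_funTS; apply: measurable_funM.
    exact: measurable_powR.
  by apply: measurableT_comp.
- by move=> s _; rewrite lee_fin mulr_ge0 ?expR_ge0// powR_ge0.
- by rewrite lee_fin fine_ge0.
apply: eq_integral => s; rewrite inE/= in_itv/= andbT => s0.
rewrite setTI VE.
have -> : [set x : @eucl R n | enorm (x : 'rV[R]_n) ^+ 2 < s] = open_ball 0 (Num.sqrt s).
  apply/seteqP; split => x; rewrite /open_ball /= subr0.
    by move=> h; rewrite -(ger0_norm (enorm_ge0 x)) -sqrtr_sqr ltr_sqrt.
  by rewrite -{1}(ger0_norm (enorm_ge0 (x : 'rV[R]_n))) -sqrtr_sqr ltr_sqrt.
have s20 : 0 < Num.sqrt s by rewrite sqrtr_gt0.
rewrite (lebesgue_open_ball_unit 0 s20) muleA -EFinM [RHS]muleC -VE; congr (_ * _ %:E)%E.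
rewrite mulrC; congr (_ * _).
by rewrite addrK mulrC powRrM powR12_sqrt ?ltW// powR_mulrn// sqrtr_ge0.
Qed.

Lemma lebesgue_unit_ball n : V n = (kappa n : R)%:E.
Proof.
have := unit_ball_Gamma_integral n.
set I := (\int[leb]_(s in _) _)%E => VI.
have VE : (fine (V n))%:E = V n.
  by rewrite fineK// ge0_fin_numE// lebesgue_unit_ball_fin.
have I0 : (0 <= I)%E.
  by apply: integral_ge0 => s _; rewrite lee_fin mulr_ge0 ?expR_ge0// powR_ge0.
have pi0 : 0 < pi `^ (n%:R / 2) :> R by rewrite powR_gt0// pi_gt0.
have V0 : 0 < fine (V n).
  rewrite lt_neqAle fine_ge0// andbT; apply/eqP => v0.
  by move: VI pi0; rewrite -v0 mul0e => -[<-]; rewrite ltxx.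
have Ifin : I \is a fin_num.
  rewrite ge0_fin_numE// ltNge leye_eq; apply/eqP => Iy.
  by move: VI; rewrite Iy gt0_muley.
have GE : Gamma (n%:R / 2 + 1) = fine I by [].
rewrite /kappa GE -VE; congr EFin.
move: VI; rewrite -(fineK Ifin) -EFinM => -[VI].
rewrite -VI mulfK//; apply/eqP => i0.
by move: VI pi0; rewrite i0 mulr0 => <-; rewrite ltxx.
Qed.

Lemma kappa_gt0 n : 0 < (kappa n : R).
Proof.
have := unit_ball_Gamma_integral n; rewrite lebesgue_unit_ball/= => h.
rewrite lt_neqAle; apply/andP; split.
  apply/eqP => k0; move: h; rewrite -k0 mul0e => -[] /esym/eqP.
  by rewrite gt_eqF// powR_gt0// pi_gt0.
by rewrite -lee_fin -lebesgue_unit_ball.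
Qed.
End BallVolume.

Section BallIntegrals.
Context {R : realType}.
Variable n : nat.
Hypothesis n0 : (0 < n)%N.
Local Notation leb := (@lebesgue_measure R).
Local Notation L := lebesgue_eucl.
Local Notation kap := (kappa n : R).

Lemma lebesgue_open_ball (y : 'rV[R]_n) s : 0 <= s ->
  L n (open_ball y s) = (kap * s ^+ n)%:E.
Proof.
rewrite le_eqVlt => /predU1P[<-|s0].
  rewrite expr0n gtn_eqF// mulr0 (_ : open_ball y 0 = set0) ?measure0//.
  by apply/seteqP; split => x //; rewrite /open_ball /= ltNge enorm_ge0.
by rewrite lebesgue_open_ball_unit// lebesgue_unit_ball -EFinM mulrC.
Qed.

Lemma measurable_origin_ball s : measurable (origin_ball s : set (@eucl R n)).
Proof. by apply: measurable_set_ler => //; exact: measurable_enorm. Qed.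

(** The closed ball is squeezed between open balls; this also shows that the
    origin is a null set, the case [s = 0]. *)
Lemma lebesgue_origin_ball s : 0 <= s ->
  L n (origin_ball s : set (@eucl R n)) = (kap * s ^+ n)%:E.
Proof.
move=> s0; have k0 := ltW (@kappa_gt0 R n).
have ub u : s < u -> (L n (origin_ball s : set (@eucl R n)) <= (kap * u ^+ n)%:E)%E.
  move=> su; rewrite -(lebesgue_open_ball 0 (ltW (le_lt_trans s0 su))).
  apply: le_measure; rewrite ?inE.
  - exact: measurable_origin_ball.
  - exact: measurable_open_ball.
  - by move=> x /=; rewrite /open_ball/= subr0 => /le_lt_trans; apply.
have fin : L n (origin_ball s : set (@eucl R n)) \is a fin_num.
  rewrite ge0_fin_numE//; apply: le_lt_trans (ub (s + 1) _) _; first by rewrite ltrDl.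
  by rewrite ltry.
apply/eqP; rewrite eq_le; apply/andP; split; last first.
  rewrite -(lebesgue_open_ball 0 s0); apply: le_measure; rewrite ?inE.
  - exact: measurable_open_ball.
  - exact: measurable_origin_ball.
  - by move=> x; rewrite /open_ball/= subr0 => /ltW.
rewrite -(fineK fin) lee_fin.
have : kap * u ^+ n @[u --> s^'+] --> kap * s ^+ n.
  by apply: cvg_at_right_filter; apply: cvgM; [exact: cvg_cst|exact: exprn_continuous].
move=> h.
apply: (@closed_cvg _ _ s^'+ _ _ (fun v => fine (L n (origin_ball s)) <= v) _ _ _ h) => //.
near=> u; rewrite -lee_fin (fineK fin); apply: ub.
by near: u; exact: nbhs_right_gt.
Unshelve. all: by end_near. Qed.

(** By layers: the region where [a kappa |x|^n < s] is a ball of volume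
    [s / a]. *)
Lemma integral_expRN_kappa a : 0 < a ->
  (\int[L n]_x (expR (- (a * (kap * enorm (x : 'rV[R]_n) ^+ n))))%:E = (a^-1)%:E)%E.
Proof.
move=> a0; have k0 := @kappa_gt0 R n.
rewrite layer_cake_expRN//; last 2 first.
- apply: measurable_funM => //; apply: measurable_funM => //.
  by apply: measurable_funX; exact: measurable_enorm.
- move=> x; apply: mulr_ge0; first exact: ltW.
  by apply: mulr_ge0; [exact: ltW|rewrite exprn_ge0// enorm_ge0].
transitivity (\int[leb]_(s in `]0%R, +oo[) ((a^-1)%:E * (expR (- s) * s)%:E))%E.
  apply: eq_integral => s; rewrite inE/= in_itv/= andbT => s0.
  have c0 : 0 < s / (a * kap) by rewrite divr_gt0// mulr_gt0.
  pose u := (s / (a * kap)) `^ (n%:R^-1).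
  have u0 : 0 < u by rewrite powR_gt0.
  have uE : u ^+ n = s / (a * kap).
    rewrite -powR_mulrn ?ltW// /u -powRrM mulVf ?powRr1 ?ltW//.
    by rewrite pnatr_eq0 gtn_eqF.
  have uP (x : 'rV[R]_n) : (enorm x < u) = (a * (kap * enorm x ^+ n) < s).
    have en : enorm x \is Num.nneg by rewrite nnegrE enorm_ge0.
    have un : u \is Num.nneg by rewrite nnegrE ltW.
    have ak0 : 0 < a * kap by exact: mulr_gt0.
    by rewrite -(ltr_pXn2r n0 en un) uE (ltr_pdivlMr _ _ ak0); congr (_ < _); ring.
  rewrite setTI (_ : [set x | _] = open_ball (0 : 'rV[R]_n) u).
    rewrite lebesgue_open_ball ?ltW// uE -!EFinM; congr EFin.
    by field; rewrite !lt0r_neq0.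
  by apply/seteqP; split => x; rewrite /open_ball /= subr0 uP.
rewrite ge0_integralZl//.
- by rewrite integral_id_expRN mule1.
- apply/measurable_EFinP/measurable_funTS; apply: measurable_funM => //.
  by apply: measurableT_comp.
- by move=> x; rewrite /= in_itv/= andbT => x0; rewrite lee_fin mulr_ge0 ?expR_ge0// ltW.
- by rewrite lee_fin invr_ge0 ltW.
Qed.
End BallIntegrals.

(** * The typical cell as a random set *)

Section Topology.
Context {R : realType}.

Lemma continuous_enorm n : continuous (@enorm R n).
Proof.
move=> x.
apply: (@continuous_comp _ _ _ (fun x : 'rV[R]_n => \sum_(i < n) x 0 i ^+ 2) Num.sqrt).
  apply: (continuous_big (@add_continuous R)) => i _ y.
  apply: (@continuous_comp _ _ _ (fun y : 'rV[R]_n => y 0 i) (fun r : R => r ^+ 2)).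
    exact: coord_continuous.
  exact: exprn_continuous.
exact: sqrt_continuous.
Qed.

Lemma open_enorm_sub_lt n :
  open [set p : 'rV[R]_n * 'rV[R]_n | enorm (p.1 - p.2) < enorm p.2].
Proof.
pose f (p : 'rV[R]_n * 'rV[R]_n) := enorm p.2 - enorm (p.1 - p.2).
have cf : continuous f.
  move=> p; apply: cvgB.
    by apply: continuous_comp; [exact: cvg_snd|exact: continuous_enorm].
  apply: (@continuous_comp _ _ _ (fun p : 'rV[R]_n * 'rV[R]_n => p.1 - p.2) (@enorm R n)).
    by apply: cvgB; [exact: cvg_fst|exact: cvg_snd].
  exact: continuous_enorm.
have /continuousP/(_ _ (@open_gt R 0)) := cf.
congr open; apply/seteqP; split => p; by rewrite /f /= subr_gt0.
Qed.

Lemma ler_coord_enorm n (x : 'rV[R]_n) i : `|x 0 i| <= enorm x.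
Proof.
rewrite -sqrtr_sqr /enorm ler_wsqrtr// (bigD1 i)//= lerDl sumr_ge0// => j _.
exact: sqr_ge0.
Qed.

Lemma ebounded_coord n (B : set 'rV[R]_n) (c : 'I_n -> R) :
  (forall x, B x -> forall i, `|x 0 i| <= c i) -> ebounded B.
Proof.
move=> Bc; exists (Num.sqrt (\sum_i c i ^+ 2)) => x /Bc xc.
rewrite /enorm ler_wsqrtr// ler_sum// => i _.
by rewrite -real_normK ?num_real// lerXn2r ?nnegrE// (le_trans _ (xc i)).
Qed.

Lemma ebounded_rat_cube n q : ebounded (@rat_cube R n q).
Proof.
apply: (@ebounded_coord _ _ (fun i => `|ratr (q.1 0 i) : R| + ratr q.2)) => x qx i.
have := qx i; have := ler_normD (ratr (q.1 0 i) - x 0 i) (- ratr (q.1 0 i)).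
by rewrite addrAC subrr add0r !normrN; lra.
Qed.

Lemma ebounded_open_ball n (y : 'rV[R]_n) s : ebounded (open_ball y s).
Proof.
apply: (@ebounded_coord _ _ (fun i => `|y 0 i| + s)) => x xy i.
have := ler_coord_enorm (x - y) i; have := ler_normD (x 0 i - y 0 i) (y 0 i).
by rewrite subrK !mxE; move: xy; rewrite /open_ball /=; lra.
Qed.

Lemma eboundedU n (A B : set 'rV[R]_n) : ebounded A -> ebounded B -> ebounded (A `|` B).
Proof.
move=> [a aA] [b bB]; exists (Num.max a b) => x [/aA|/bB] h.
  by rewrite le_max h.
by rewrite le_max h orbT.
Qed.

End Topology.

Section Tonelli.
Context {R : realType}.

Lemma tonelli_set d1 d2 (T1 : measurableType d1) (T2 : measurableType d2)
    (m1 : {sigma_finite_measure set T1 -> \bar R})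
    (m2 : {sigma_finite_measure set T2 -> \bar R}) (S : set (T1 * T2)) :
  measurable S ->
  (\int[m1]_x m2 (xsection S x) = \int[m2]_y m1 (ysection S y))%E.
Proof.
move=> mS; have := indic_fubini_tonelli m1 m2 mS.
rewrite indic_fubini_tonelli_FE// indic_fubini_tonelli_GE//.
Qed.

Lemma fine_pM (a : R) (x : \bar R) : 0 < a -> fine (a%:E * x)%E = a * fine x.
Proof.
move=> a0; case: x => [x| |] //=.
  by rewrite gt0_muley ?lte_fin//= mulr0.
by rewrite gt0_muleNy ?lte_fin//= mulr0.
Qed.
End Tonelli.

Section TypicalCell.
Context {R : realType} {d : nat} {disp : measure_display}
  {Omega : measurableType disp} {P : probability Omega R} {lambda : R}
  {Phi : Omega -> set 'rV[R]_d}.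
Hypothesis PhiP : poisson_point_process P lambda Phi.
Local Notation L := (@lebesgue_eucl R d).
Local Notation E := (@eucl R d).

Lemma npoints_eq0 B w : (npoints Phi B w = 0%E) <-> (Phi w `&` B = set0).
Proof.
rewrite /npoints /counting; split => [|->]; last first.
  by rewrite asboolT ?fset_set0//; exact: finite_set0.
case: asboolP => // fB [] /eqP; rewrite pnatr_eq0 finmap.cardfs_eq0 => /eqP h.
by apply: fset_set_inj; rewrite ?h ?fset_set0.
Qed.

Lemma measurable_void (B : set 'rV[R]_d) : borel B -> ebounded B ->
  measurable [set w | Phi w `&` B = set0].
Proof.
move=> mB bB; have := ppp_measurable PhiP mB bB measurableT (emeasurable_set1 0%E).
rewrite setTI; congr measurable.
by apply/seteqP; split => w /npoints_eq0.
Qed.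

Lemma void_probability (B : set 'rV[R]_d) : borel B -> ebounded B ->
  P [set w | Phi w `&` B = set0] = (expR (- (lambda * fine (vol B))))%:E.
Proof.
move=> mB bB; have := ppp_poisson PhiP 0 mB bB.
rewrite /= expr0 fact0 divr1 mul1r => <-; congr (P _).
by apply/seteqP; split => w /npoints_eq0.
Qed.

Lemma typical_cellP w (y : 'rV[R]_d) :
  typical_cell Phi w y <-> Phi w `&` open_ball y (enorm y) = set0.
Proof.
split => [Vy|h x Phix].
  by apply/seteqP; split => // x [/Vy] /=; rewrite /open_ball/= leNgt => /negP.
rewrite leNgt; apply/negP => hx.
by have : (Phi w `&` open_ball y (enorm y)) x by []; rewrite h.
Qed.

(** The pairs [(x, y)] such that [x] lies in the hole of [y] form an open set,
    hence a countable union of products of rational cubes. So [y] is outside the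
    cell iff for one of these products a point of the process hits the first
    cube while [y] is in the second. *)
Lemma measurable_typical_cell :
  measurable [set p : Omega * E | typical_cell Phi p.1 p.2].
Proof.
pose U := [set p : 'rV[R]_d * 'rV[R]_d | enorm (p.1 - p.2) < enorm p.2].
have -> : [set p : Omega * E | typical_cell Phi p.1 p.2] =
    ~` \bigcup_(q in [set q : ('rV[rat]_d * rat) * ('rV[rat]_d * rat) |
       rat_cube q.1 `*` rat_cube q.2 `<=` U])
     ([set w | ~ (Phi w `&` rat_cube q.1 = set0)] `*` (rat_cube q.2 : set E)).
  apply/seteqP; split => [[w y] /= Vy [q /= qU [/= h1 h2]]|[w y] /= h x Phix].
    apply: h1; apply/seteqP; split => // x [Phix xq].
    have := qU (x, y) (conj xq h2); rewrite /U /= ltNge => /negP; apply.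
    exact: Vy.
  rewrite leNgt; apply/negP => xy; apply: h.
  have oU : open U by exact: open_enorm_sub_lt.
  have : nbhs (x, y) U by apply: open_nbhs_nbhs; split.
  move=> [[A B] /= [nA nB] AB].
  have [q1 [q1x q1A]] := nbhs_rat_cube nA.
  have [q2 [q2y q2B]] := nbhs_rat_cube nB.
  exists (q1, q2) => /=.
    by move=> [a b] [/= /q1A Aa /q2B Bb]; exact: AB.
  split => //= h; suff : (Phi w `&` rat_cube q1) x by rewrite h.
  by [].
apply: measurableC; rewrite bigcup_mkcond; apply: countable_bigcupT_measurable => //.
move=> q; case: ifPn => _ //; apply: measurableX.
  apply: measurableC; apply: measurable_void; last exact: ebounded_rat_cube.
  by apply: (@measurable_rat_cube R _ E d id); exact: measurable_eucl_coord.
by apply: (@measurable_rat_cube R _ E d id); exact: measurable_eucl_coord.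
Qed.

End TypicalCell.

(** * Holes of pairs of points *)

Section HoleVolume.
Context {R : realType} {d : nat}.
Hypothesis d0 : (0 < d)%N.
Local Notation L := (@lebesgue_eucl R d).
Local Notation E := (@eucl R d).
Local Notation kap := (kappa d : R).

(** Both points belong to the cell exactly when this set is void of points of the
    process. *)
Definition hole (p : E * E) : set E :=
  open_ball p.1 (enorm (p.1 : 'rV[R]_d)) `|` open_ball p.2 (enorm (p.2 : 'rV[R]_d)).

Definition hole_vol (p : E * E) : R := fine (L (hole p)).

Lemma measurable_hole p : measurable (hole p).
Proof. by apply: measurableU; exact: measurable_open_ball. Qed.

Lemma lebesgue_hole_le p : (L (hole p) <=
  (kap * enorm (p.2 : 'rV[R]_d) ^+ d + kap * enorm (p.1 : 'rV[R]_d) ^+ d)%:E)%E.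
Proof.
rewrite addrC EFinD -(lebesgue_open_ball d0 p.1 (enorm_ge0 _)).
rewrite -(lebesgue_open_ball d0 p.2 (enorm_ge0 _)).
by apply: measureU2; exact: measurable_open_ball.
Qed.

Lemma lebesgue_hole_fin p : L (hole p) \is a fin_num.
Proof.
by rewrite ge0_fin_numE//; apply: le_lt_trans (lebesgue_hole_le p) _; rewrite ltry.
Qed.

Lemma le_hole_vol p : kap * enorm (p.2 : 'rV[R]_d) ^+ d <= hole_vol p <=
  kap * enorm (p.2 : 'rV[R]_d) ^+ d + kap * enorm (p.1 : 'rV[R]_d) ^+ d.
Proof.
rewrite -!lee_fin (fineK (lebesgue_hole_fin p)) lebesgue_hole_le andbT.
rewrite -(lebesgue_open_ball d0 p.2 (enorm_ge0 _)).
apply: le_measure; rewrite ?inE//; first exact: measurable_open_ball.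
  exact: measurable_hole.
by move=> x; right.
Qed.

Lemma hole_vol_ge0 p : 0 <= hole_vol p.
Proof. exact: fine_ge0. Qed.

Lemma measurable_hole_vol : measurable_fun [set: E * E] hole_vol.
Proof.
pose S := [set q : (E * E) * E | hole q.1 q.2].
have mS : measurable S.
  have h (f : E * E -> E) : measurable_fun [set: E * E] f ->
      measurable [set q : (E * E) * E | open_ball (f q.1) (enorm (f q.1 : 'rV[R]_d)) q.2].
    move=> mf; have mf1 : measurable_fun [set: (E * E) * E] (fun q => f q.1).
      exact: measurableT_comp mf measurable_fst.
    apply: measurable_set_ltr; last exact: measurable_fun_enorm.
    by apply: measurable_fun_enorm; apply: measurable_fun_eucl_sub => //; exact: measurable_snd.
  have -> : S = [set q : (E * E) * E | open_ball q.1.1 (enorm (q.1.1 : 'rV[R]_d)) q.2] `|`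
     [set q : (E * E) * E | open_ball q.1.2 (enorm (q.1.2 : 'rV[R]_d)) q.2] by [].
  by apply: measurableU; [exact: (h fst)|exact: (h snd)].
have := measurable_fun_xsection L mS.
move=> /(measurableT_comp (@fine_measurable _ _ measurableT)).
congr measurable_fun; apply/funext => p /=; congr (fine (L _)).
by apply/seteqP; split => x /=; rewrite /xsection /= inE.
Qed.

Lemma hole_vol_scale (r : R) p : 0 < r ->
  hole_vol (r *: (p.1 : 'rV[R]_d), r *: (p.2 : 'rV[R]_d)) = r ^+ d * hole_vol p.
Proof.
move=> r0; rewrite /hole_vol.
set q : E * E := (_, _).
have -> : hole p = [set v : E | hole q (r *: (v : 'rV[R]_d) + 0)].
  apply/seteqP; split => v; rewrite /hole /open_ball /= addr0 -!scalerBr !enormZ ?ltW// !ltr_pM2l//.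
rewrite lebesgue_eucl_affine//; last exact: measurable_hole.
rewrite fineM ?lebesgue_hole_fin//= mulrA divff ?mul1r// expf_neq0// lt0r_neq0//.
Qed.

Lemma exists_lebesgue_eucl2 : exists m : {sigma_finite_measure set (E * E)%type -> \bar R},
  forall A, m A = (L \x L)%E A.
Proof. exact: measure_sigma_finite (product_measure_sigma_finite L L). Qed.

Definition lebesgue_eucl2 : {sigma_finite_measure set (E * E)%type -> \bar R} :=
  projT1 (cid exists_lebesgue_eucl2).

Lemma lebesgue_eucl2E A : lebesgue_eucl2 A = (L \x L)%E A.
Proof. by rewrite /lebesgue_eucl2; case: cid. Qed.

Lemma ge0_integral_eucl2 (f : E * E -> \bar R) :
  measurable_fun [set: E * E] f -> (forall p, 0 <= f p)%E ->
  (\int[lebesgue_eucl2]_p f p = \int[L]_y \int[L]_z f (y, z))%E.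
Proof.
move=> mf f0; rewrite (eq_measure_integral (L \x L)%E); last first.
  by move=> A mA _; exact: lebesgue_eucl2E.
by rewrite fubini_tonelli1.
Qed.

Lemma ge0_integral_eucl2_scale (r : R) (f : E * E -> \bar R) : 0 < r ->
  measurable_fun [set: E * E] f -> (forall p, 0 <= f p)%E ->
  (\int[lebesgue_eucl2]_p f p = (r ^+ d * r ^+ d)%:E *
   \int[lebesgue_eucl2]_p f (r *: (p.1 : 'rV[R]_d), r *: (p.2 : 'rV[R]_d))%R)%E.
Proof.
move=> r0 mf f0; have rd0 : 0 <= r ^+ d by rewrite exprn_ge0// ltW.
have ms : measurable_fun [set: E * E]
    (fun p : E * E => (r *: (p.1 : 'rV[R]_d), r *: (p.2 : 'rV[R]_d)) : E * E).
  by apply: measurable_fun_pair; apply: measurable_fun_eucl_scale.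
rewrite !ge0_integral_eucl2//; last exact: measurableT_comp mf ms.
have mF : measurable_fun [set: E] (fun y => \int[L]_z f (y, z))%E.
  exact: measurable_fun_fubini_tonelli_F.
rewrite (ge0_integral_eucl_scale r0 mF); last by move=> y; exact: integral_ge0.
rewrite EFinM -muleA; congr (_ * _)%E.
rewrite -ge0_integralZl//.
- apply: eq_integral => y _;
  apply: (@ge0_integral_eucl_scale R d r (fun z => f (r *: (y : 'rV[R]_d), z))) => //.
  by apply: measurableT_comp mf _; exact: measurable_fun_pair.
- apply: (@measurable_fun_fubini_tonelli_F _ _ _ _ _ L (fun p : E * E =>
    f (r *: (p.1 : 'rV[R]_d), r *: (p.2 : 'rV[R]_d)))) => //.
  exact: measurableT_comp mf ms.
- by move=> y _; exact: integral_ge0.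
Qed.

Lemma measurable_expRN_kappa a : measurable_fun [set: E]
  (fun y => (expR (- (a * (kap * enorm (y : 'rV[R]_d) ^+ d))))%:E).
Proof.
apply/measurable_EFinP; apply: measurableT_comp => //.
apply: measurableT_comp => //; apply: measurable_funM => //.
by apply: measurable_funM => //; apply: measurable_funX; exact: measurable_enorm.
Qed.

Lemma integral_eucl2_kappa (D : set E) a : measurable D -> 0 < a ->
  (\int[lebesgue_eucl2]_(p in D `*` [set: E])
     (expR (- (a * (kap * enorm (p.2 : 'rV[R]_d) ^+ d))))%:E = L D * (a^-1)%:E)%E.
Proof.
move=> mD a0.
have mDT : measurable (D `*` [set: E]) by exact: measurableX.
have mf : measurable_fun [set: E * E]
    (fun p => (expR (- (a * (kap * enorm (p.2 : 'rV[R]_d) ^+ d))))%:E).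
  exact: measurableT_comp (measurable_expRN_kappa a) measurable_snd.
rewrite integral_mkcond ge0_integral_eucl2; last 2 first.
- by apply/(measurable_restrictT _ mDT); exact: measurable_funTS.
- by move=> p; rewrite patchE; case: ifPn => // _; rewrite lee_fin expR_ge0.
transitivity (\int[L]_y ((\1_D y)%:E * (a^-1)%:E))%E.
  apply: eq_integral => y _; rewrite indicE.
  rewrite -(integral_expRN_kappa d0 a0).
  have [yD|yD] := boolP (y \in D).
    rewrite mul1e; apply: eq_integral => z _; rewrite patchE ifT//.
    by rewrite inE; split => //; rewrite inE in yD.
  rewrite mul0e integral0_eq// => z _; rewrite patchE ifF//.
  apply/negbTE; rewrite notin_setE /= => -[Dy _].
  by move: yD; rewrite notin_setE; apply.
rewrite ge0_integralZr//.
- by rewrite integral_indic// setIT.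
- by apply/measurable_EFinP; exact: measurable_indic.
- by rewrite lee_fin invr_ge0 ltW.
Qed.
End HoleVolume.

(** * Moments of the cell volumes *)

Section RandomSets.
Context {R : realType} {disp : measure_display} {Omega : measurableType disp}
  (P : probability Omega R).

(** Mean measure of a random set: integrate the probability of covering a
    point. *)
Lemma integral_random_set d (X : measurableType d)
    (m : {sigma_finite_measure set X -> \bar R}) (S : set (Omega * X))
    (D : set X) (q : X -> R) :
  measurable S -> (forall x, ~ D x -> P (ysection S x) = 0%E) ->
  (forall x, D x -> P (ysection S x) = (q x)%:E) ->
  (\int[P]_w m (xsection S w) = \int[m]_(x in D) (q x)%:E)%E.
Proof.
move=> mS SD Sq; rewrite tonelli_set// [RHS]integral_mkcond.
apply: eq_integral => x _; rewrite patchE; case: ifPn.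
  by rewrite inE => /Sq.
by rewrite notin_setE => /SD.
Qed.

(** A nonnegative variable of finite mean is almost surely finite, so [fine] leaves
    its mean unchanged. *)
Lemma integral_fine (f : Omega -> \bar R) :
  measurable_fun [set: Omega] f -> (forall w, 0 <= f w)%E ->
  (\int[P]_w f w < +oo)%E ->
  P.-integrable [set: Omega] (EFin \o (fine \o f)) /\
  (\int[P]_w (fine (f w))%:E = \int[P]_w f w)%E.
Proof.
move=> mf f0 foo.
have mff : measurable_fun [set: Omega] (EFin \o (fine \o f)).
  by apply/measurable_EFinP; exact: measurableT_comp (@fine_measurable _ _ measurableT) mf.
have fint : P.-integrable [set: Omega] f.
  apply/integrableP; split => //.
  by under eq_integral do rewrite gee0_abs//.
have E : (\int[P]_w (fine (f w))%:E = \int[P]_w f w)%E.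
  apply: ge0_ae_eq_integral => //.
  - by move=> w _; rewrite lee_fin fine_ge0.
  - have := integrable_ae measurableT fint.
    by apply: filterS => w /(_ I) h _; rewrite fineK.
split => //; apply/integrableP; split => //.
under eq_integral do rewrite /= ger0_norm ?fine_ge0//.
by rewrite E.
Qed.
End RandomSets.

Section Moments.
Context {R : realType} {d : nat} {disp : measure_display}
  {Omega : measurableType disp} {P : probability Omega R} {lambda : R}
  {Phi : Omega -> set 'rV[R]_d}.
Hypothesis d0 : (0 < d)%N.
Hypothesis lambda0 : 0 < lambda.
Hypothesis PhiP : poisson_point_process P lambda Phi.
Local Notation L := (@lebesgue_eucl R d).
Local Notation E := (@eucl R d).
Local Notation kap := (kappa d : R).
Local Notation V := (typical_cell Phi).

Lemma prob_cell (y : E) :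
  P [set w | V w y] = (expR (- (lambda * (kap * enorm (y : 'rV[R]_d) ^+ d))))%:E.
Proof.
have mB := measurable_open_ball y (enorm (y : 'rV[R]_d)).
have := void_probability PhiP mB (@ebounded_open_ball R d y _).
rewrite -lebesgue_euclE lebesgue_open_ball ?enorm_ge0//= => <-.
by congr (P _); apply/seteqP; split => w /typical_cellP.
Qed.

Lemma prob_cell2 (p : E * E) :
  P [set w | V w p.1 /\ V w p.2] = (expR (- (lambda * hole_vol p)))%:E.
Proof.
have mB : measurable (hole p) by exact: measurable_hole.
have bB : ebounded (hole p) by apply: eboundedU; exact: ebounded_open_ball.
have := void_probability PhiP mB bB.
rewrite -lebesgue_euclE => <-.
congr (P _); apply/seteqP; split => w /=.
  by move=> [/typical_cellP h1 /typical_cellP h2]; rewrite /hole setIUr h1 h2 setU0.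
rewrite /hole setIUr setU_eq0 => -[h1 h2].
by split; exact/typical_cellP.
Qed.

Lemma measurable_cell w : measurable (V w : set E).
Proof.
have := measurable_xsection w (measurable_typical_cell PhiP).
by congr measurable; apply/seteqP; split => y; rewrite /xsection /= inE.
Qed.

Lemma measurable_lebesgue_cell (D : set E) : measurable D ->
  measurable_fun [set: Omega] (fun w => L (D `&` V w)).
Proof.
move=> mD.
have mS : measurable ([set: Omega] `*` D `&` [set p : Omega * E | V p.1 p.2]).
  by apply: measurableI; [exact: measurableX|exact: measurable_typical_cell PhiP].
have := measurable_fun_xsection L mS.
congr measurable_fun; apply/funext => w /=; congr (L _).
by apply/seteqP; split => y; rewrite /xsection /= inE/=; tauto.
Qed.

Lemma integral_lebesgue_cell (D : set E) : measurable D ->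
  (\int[P]_w L (D `&` V w) =
   \int[L]_(y in D) (expR (- (lambda * (kap * enorm (y : 'rV[R]_d) ^+ d))))%:E)%E.
Proof.
move=> mD.
have mS : measurable ([set: Omega] `*` D `&` [set p : Omega * E | V p.1 p.2]).
  by apply: measurableI; [exact: measurableX|exact: measurable_typical_cell PhiP].
rewrite -(@integral_random_set _ _ _ P _ _ L _ D _ mS).
- apply: eq_integral => w _; congr (L _).
  by apply/seteqP; split => y; rewrite /xsection /= inE/=; tauto.
- move=> y Dy; rewrite (_ : ysection _ _ = set0) ?measure0//.
  by apply/seteqP; split => w //; rewrite /ysection /= inE/= => -[[_ /Dy]].
- move=> y Dy; rewrite -prob_cell; congr (P _).
  by apply/seteqP; split => w; rewrite /ysection /= inE/=; tauto.
Qed.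

(** The product of the two volumes is the measure of a random set of pairs. *)
Lemma integral_lebesgue_cell2 (D : set E) : measurable D ->
  (\int[P]_w (L (D `&` V w) * L (V w)) =
   \int[lebesgue_eucl2]_(p in D `*` [set: E]) (expR (- (lambda * hole_vol p)))%:E)%E.
Proof.
move=> mD.
have mC := measurable_typical_cell PhiP.
have mS : measurable ([set: Omega] `*` (D `*` [set: E]) `&`
    [set p : Omega * (E * E) | V p.1 p.2.1 /\ V p.1 p.2.2]).
  apply: measurableI; first by apply: measurableX => //; exact: measurableX.
  have mf1 : measurable_fun [set: Omega * (E * E)] (fun p => (p.1, p.2.1)).
    apply: measurable_fun_pair; first exact: measurable_fst.
    exact: measurableT_comp measurable_fst measurable_snd.
  have mf2 : measurable_fun [set: Omega * (E * E)] (fun p => (p.1, p.2.2)).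
    apply: measurable_fun_pair; first exact: measurable_fst.
    exact: measurableT_comp measurable_snd measurable_snd.
  have := measurableI _ _ (mf1 measurableT _ mC) (mf2 measurableT _ mC).
  by rewrite !setTI.
rewrite -(@integral_random_set _ _ _ P _ _ lebesgue_eucl2 _ (D `*` [set: E]) _ mS).
- apply: eq_integral => w _; rewrite lebesgue_eucl2E -product_measure1E; last 2 first.
  + by apply: measurableI => //; exact: measurable_cell.
  + exact: measurable_cell.
  congr ((L \x L)%E _).
  apply/seteqP; split => -[y z]; rewrite /xsection /= inE/=.
    by move=> [[? ?] ?].
  by move=> [[_ [? _]] [? ?]].
- move=> p Dp; rewrite (_ : ysection _ _ = set0) ?measure0//.
  by apply/seteqP; split => w //; rewrite /ysection /= inE/= => -[[_ /Dp]].
- move=> p [/= Dp _]; rewrite -prob_cell2; congr (P _).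
  by apply/seteqP; split => w; rewrite /ysection /= inE/=; tauto.
Qed.

Lemma cell_vol_moment : P.-integrable [set: Omega] (EFin \o cell_vol Phi) /\
  ('E_P[cell_vol Phi] = (lambda^-1)%:E)%E.
Proof.
have IE : (\int[P]_w L (V w) = (lambda^-1)%:E)%E.
  rewrite -(integral_expRN_kappa d0 lambda0) -(integral_lebesgue_cell measurableT).
  by apply: eq_integral => w _; rewrite setTI.
have mV : measurable_fun [set: Omega] (fun w => L (V w)).
  have := measurable_lebesgue_cell measurableT.
  by under eq_fun do rewrite setTI.
have cE : cell_vol Phi = fine \o (fun w => L (V w)).
  by apply/funext => w; rewrite /cell_vol /= lebesgue_euclE.
have [||iV IV] := @integral_fine R _ Omega P _ mV.
- by move=> w; exact: measure_ge0.
- by rewrite IE ltry.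
by rewrite cE; split => //; rewrite unlock; apply: etrans IV IE.
Qed.

Lemma ball_cell_volE r w : ball_cell_vol Phi r w =
  fine (L ((origin_ball r : set E) `&` V w)).
Proof. by rewrite /ball_cell_vol lebesgue_euclE. Qed.

Lemma ball_cell_vol_moment r : 0 <= r ->
  P.-integrable [set: Omega] (EFin \o ball_cell_vol Phi r) /\
  ('E_P[ball_cell_vol Phi r] = \int[L]_(y in origin_ball r)
     (expR (- (lambda * (kap * enorm (y : 'rV[R]_d) ^+ d))))%:E)%E.
Proof.
move=> r0.
have mB := @measurable_origin_ball R d r.
have bE : ball_cell_vol Phi r = fine \o (fun w => L ((origin_ball r : set E) `&` V w)).
  by apply/funext => w; exact: ball_cell_volE.
have [||iV IV] := @integral_fine R _ Omega P _ (measurable_lebesgue_cell mB).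
- by move=> w; exact: measure_ge0.
- rewrite integral_lebesgue_cell//.
  apply: (@le_lt_trans _ _ (lambda^-1)%:E); last by rewrite ltry.
  rewrite -(integral_expRN_kappa d0 lambda0); apply: ge0_subset_integral => //.
  exact: measurable_expRN_kappa.
rewrite bE; split => //; rewrite unlock; apply: etrans IV _.
exact: integral_lebesgue_cell.
Qed.

Lemma cell_product_moment r : 0 <= r ->
  P.-integrable [set: Omega] (EFin \o (ball_cell_vol Phi r * cell_vol Phi)) /\
  ('E_P[(ball_cell_vol Phi r * cell_vol Phi)%R] =
  \int[lebesgue_eucl2]_(p in (origin_ball r : set E) `*` [set: E])
     (expR (- (lambda * hole_vol p)))%:E)%E.
Proof.
move=> r0.
have mB := @measurable_origin_ball R d r.
have mV : measurable_fun [set: Omega] (fun w => L (V w)).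
  have := measurable_lebesgue_cell measurableT.
  by under eq_fun do rewrite setTI.
have fin w : L ((origin_ball r : set E) `&` V w) \is a fin_num.
  rewrite ge0_fin_numE//; apply: (@le_lt_trans _ _ (L (origin_ball r : set E))).
    apply: le_measure; rewrite ?inE//.
    by apply: measurableI => //; exact: measurable_cell.
  by rewrite lebesgue_origin_ball// ltry.
have bE : (ball_cell_vol Phi r * cell_vol Phi)%R =
    fine \o (fun w => L ((origin_ball r : set E) `&` V w) * L (V w))%E.
  apply/funext => w; rewrite /= -[LHS]/(ball_cell_vol Phi r w * cell_vol Phi w).
  rewrite ball_cell_volE /cell_vol -lebesgue_euclE.
  (* If the cell has infinite volume both sides are 0, since [fine +oo = 0]. *)
  have [Vfin|] := boolP (L (V w) \is a fin_num); first by rewrite fineM.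
  rewrite ge0_fin_numE// -leNgt leye_eq => /eqP ->; rewrite mulr0 -(fineK (fin w)).
  have [->|x0] := eqVneq (fine (L ((origin_ball r : set E) `&` V w))) 0.
    by rewrite mul0e.
  by rewrite gt0_muley// lte_fin lt_neqAle eq_sym x0 fine_ge0.
have [|||iV IV] := @integral_fine _ _ _ P
    (fun w => L ((origin_ball r : set E) `&` V w) * L (V w))%E.
- by apply: emeasurable_funM => //; exact: measurable_lebesgue_cell.
- by move=> w; exact: mule_ge0.
- rewrite integral_lebesgue_cell2//.
  apply: (@le_lt_trans _ _ (L (origin_ball r : set E) * (lambda^-1)%:E)%E); last first.
    by rewrite lebesgue_origin_ball// -EFinM ltry.
  rewrite -integral_eucl2_kappa//; apply: ge0_le_integral => //.
  + exact: measurableX.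
  + apply: measurable_funTS; apply/measurable_EFinP.
    apply: measurableT_comp => //; apply: measurableT_comp => //.
    by apply: measurable_funM => //; exact: measurable_hole_vol.
  + apply: measurable_funTS.
    exact: measurableT_comp (measurable_expRN_kappa lambda) measurable_snd.
  + move=> p _; rewrite lee_fin ler_expR lerN2 ler_pM2l//.
    by have /andP[] := le_hole_vol d0 p.
rewrite bE; split => //; rewrite unlock; apply: etrans IV _.
exact: integral_lebesgue_cell2.
Qed.

End Moments.

(** * Expansion of the Taylor approximation at 0 *)

Section Expansion.
Context {R : realType} {d : nat} {disp : measure_display}
  {Omega : measurableType disp} {P : probability Omega R} {lambda : R}
  {Phi : Omega -> set 'rV[R]_d}.
Hypothesis d0 : (0 < d)%N.
Hypothesis lambda0 : 0 < lambda.
Hypothesis PhiP : poisson_point_process P lambda Phi.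
Local Notation L := (@lebesgue_eucl R d).
Local Notation L2 := (@lebesgue_eucl2 R d).
Local Notation E := (@eucl R d).
Local Notation kap := (kappa d : R).
Local Notation B := (origin_ball 1 : set E).

Let one_hole (y : E) : R := lambda * (kap * enorm (y : 'rV[R]_d) ^+ d).
Let second_hole (p : E * E) : R := lambda * (kap * enorm (p.2 : 'rV[R]_d) ^+ d).
Let two_holes (p : E * E) : R := lambda * hole_vol p.

Let mB : measurable B. Proof. exact: measurable_origin_ball. Qed.
Let integral_ball1 : (\int[L]_(y in B) 1 = kap%:E)%E.
Proof.
rewrite integral_cst// mul1e; apply: etrans (lebesgue_origin_ball d0 ler01) _.
by rewrite expr1n mulr1.
Qed.

Let mBT : measurable (B `*` [set: E]). Proof. exact: measurableX. Qed.

Let kap_ge0 : 0 <= kap. Proof. exact: ltW (@kappa_gt0 R d). Qed.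

Let lambda_kap_ge0 : 0 <= lambda * kap.
Proof. by apply: mulr_ge0 => //; exact: ltW. Qed.

Let one_hole_ge0 y : 0 <= one_hole y.
Proof. by rewrite /one_hole mulrA mulr_ge0// exprn_ge0// enorm_ge0. Qed.

Let measurable_one_hole : measurable_fun [set: E] one_hole.
Proof.
apply: measurable_funM => //; apply: measurable_funM => //.
by apply: measurable_funX; exact: measurable_enorm.
Qed.

Let measurable_two_holes : measurable_fun [set: E * E] two_holes.
Proof. by apply: measurable_funM => //; exact: measurable_hole_vol. Qed.

Lemma one_hole_scale (r : R) (y : 'rV[R]_d) : 0 <= r -> one_hole (r *: y) = r ^+ d * one_hole y.
Proof. by move=> r0; rewrite /one_hole enormZ// exprMn; ring. Qed.

(** Here [p = 0] and [g0 = 0], the unit ball having finite volume. *)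
Definition mean_remainder := laplace_diff L B (fun=> 0) one_hole 0 0.
(** Here [p = 1], by [integral_eucl2_kappa]; the holes of the second point serve as
    [g0], and the first point ranges over the unit ball, so that the union of
    the holes exceeds the second hole by at most [kappa]. *)
Definition product_remainder := laplace_diff L2 (B `*` [set: E]) second_hole two_holes 1 0.

Lemma flat_mean_remainder n : flat n mean_remainder.
Proof.
apply: (@flat_laplace_diff _ _ _ L B mB _ _ _ (lambda * kap) kap) => //.
- exact: measurable_funTS measurable_one_hole.
- move=> y; rewrite add0r /origin_ball/= => y1.
  rewrite /one_hole mulrA ler_piMr//.
  by apply: exprn_ile1 => //; exact: enorm_ge0.
- move=> t t0; rewrite expr0 divr1.
  under eq_integral do rewrite mulr0 oppr0 expR0.
  by rewrite integral_ball1.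
Qed.

Lemma flat_product_remainder n : flat n product_remainder.
Proof.
apply: (@flat_laplace_diff _ _ _ L2 _ mBT _ _ _ (lambda * kap) (kap / lambda)) => //.
- apply: measurable_funTS.
  exact: measurableT_comp measurable_one_hole measurable_snd.
- exact: measurable_funTS measurable_two_holes.
- by move=> p; exact: one_hole_ge0.
- by move=> p; rewrite mulr_ge0 ?hole_vol_ge0// ltW.
- by move=> p _; rewrite ler_pM2l//; have /andP[] := le_hole_vol d0 p.
- move=> p [/= p1 _].
  rewrite /two_holes /second_hole -mulrDr ler_pM2l//.
  have /andP[_ /le_trans] := le_hole_vol d0 p; apply.
  rewrite lerD2l ler_piMr//.
  by apply: exprn_ile1 => //; exact: enorm_ge0.
- move=> t t0; rewrite expr1.
  under eq_integral do rewrite /second_hole mulrA.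
  rewrite integral_eucl2_kappa// ?mulr_gt0//.
  rewrite lebesgue_origin_ball// expr1n mulr1 -EFinM lee_fin.
  by rewrite le_eqVlt; apply/orP; left; apply/eqP; field; rewrite !lt0r_neq0.
Qed.

Lemma ball_cell_vol0 : ball_cell_vol Phi 0 = cst 0.
Proof.
apply/funext => w; rewrite ball_cell_volE /=.
suff -> : L ((origin_ball 0 : set E) `&` typical_cell Phi w) = 0%E by [].
apply/eqP; rewrite -measure_le0; apply: (@le_trans _ _ (L (origin_ball 0 : set E))).
  apply: le_measure; rewrite ?inE//.
    by apply: measurableI; [exact: measurable_origin_ball|exact: (measurable_cell PhiP)].
  exact: measurable_origin_ball.
by rewrite lebesgue_origin_ball// expr0n gtn_eqF// mulr0.
Qed.

Lemma mean_ball_cell r : 0 <= r ->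
  fine 'E_P[ball_cell_vol Phi r] = r ^+ d * (kap + mean_remainder (r ^+ d)).
Proof.
rewrite le_eqVlt => /predU1P[<-|r0].
  by rewrite ball_cell_vol0 expectation_cst expr0n gtn_eqF// mul0r.
have [_ ->] := ball_cell_vol_moment d0 lambda0 PhiP (ltW r0).
rewrite /mean_remainder /laplace_diff expr0 !mul1r.
have -> : laplace L B (fun=> 0) 0 (r ^+ d) = kap.
  rewrite /laplace /Rintegral.
  under eq_integral do rewrite expr0 mul1r mulr0 oppr0 expR0.
  by rewrite integral_ball1.
have mr := @measurable_origin_ball R d r.
rewrite addrCA subrr addr0 /laplace /Rintegral.
rewrite [in LHS]integral_mkcond.
rewrite [X in fine X = _](ge0_integral_eucl_scale r0); last 2 first.
- apply/(measurable_restrictT _ mr); apply: measurable_funTS.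
  exact: measurable_expRN_kappa.
- by move=> y; rewrite patchE; case: ifPn => // _; rewrite lee_fin expR_ge0.
rewrite fine_pM ?exprn_gt0//; congr (_ * fine _).
rewrite [RHS]integral_mkcond; apply: eq_integral => y _.
have h := one_hole_scale y (ltW r0); rewrite {1}/one_hole in h.
rewrite !patchE h expr0 mul1r.
congr (if _ then _ else _); apply/idP/idP;
  by rewrite !inE /origin_ball /= (enormZ _ (ltW r0)) ger_pMr.
Qed.

Lemma mean_product r : 0 <= r ->
  fine 'E_P[(ball_cell_vol Phi r * cell_vol Phi)%R] =
  r ^+ d * (kap / lambda + product_remainder (r ^+ d)).
Proof.
rewrite le_eqVlt => /predU1P[<-|r0].
  rewrite ball_cell_vol0 (_ : cst 0 * _ = cst 0).
    by rewrite expectation_cst expr0n gtn_eqF// mul0r.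
  by apply/funext => w; exact: mul0r.
have [_ ->] := cell_product_moment d0 lambda0 PhiP (ltW r0).
have rd0 : 0 < r ^+ d by exact: exprn_gt0.
rewrite /product_remainder /laplace_diff expr1.
have -> : r ^+ d * laplace L2 (B `*` [set: E]) second_hole 0 (r ^+ d) = kap / lambda.
  rewrite /laplace /Rintegral.
  under eq_integral do rewrite expr0 mul1r /second_hole mulrA.
  rewrite integral_eucl2_kappa ?mulr_gt0//.
  rewrite lebesgue_origin_ball// expr1n mulr1 -EFinM /=.
  by field; rewrite !lt0r_neq0.
rewrite addrCA subrr addr0 /laplace /Rintegral.
rewrite [in LHS]integral_mkcond.
have mr : measurable ((origin_ball r : set E) `*` [set: E]).
  by apply: measurableX => //; exact: measurable_origin_ball.
rewrite [X in fine X = _](ge0_integral_eucl2_scale r0); last 2 first.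
- apply/(measurable_restrictT _ mr); apply: measurable_funTS.
  apply/measurable_EFinP; apply: measurableT_comp => //.
  exact: measurableT_comp measurable_two_holes.
- by move=> y; rewrite patchE; case: ifPn => // _; rewrite lee_fin expR_ge0.
rewrite fine_pM ?mulr_gt0// -mulrA; congr (_ * (_ * fine _)).
rewrite [RHS]integral_mkcond; apply: eq_integral => p _.
rewrite !patchE (hole_vol_scale d0 p r0) expr0 mul1r mulrCA.
congr (if _ then _ else _); apply/idP/idP;
  by rewrite !inE /origin_ball /= (enormZ _ (ltW r0)) ger_pMr.
Qed.

(** The covariance is [r ^ d] times a combination of remainders: the leading terms
    of E[Z1 Z2] and of E[Z1] E[Z2] are both [kappa / lambda]. *)
Lemma taylor2_expansion r : 0 <= r ->
  let W := fine 'V_P[cell_vol Phi] in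
  taylor2_cdf P Phi r = r ^+ d * (kap * lambda * (1 + lambda ^+ 2 * W) +
   ((2 * lambda + lambda ^+ 3 * W) * mean_remainder (r ^+ d) +
    (- lambda ^+ 2) * product_remainder (r ^+ d))).
Proof.
move=> r0 W; have [iV EV] := cell_vol_moment d0 lambda0 PhiP.
have [ib _] := ball_cell_vol_moment d0 lambda0 PhiP r0.
have [ibV _] := cell_product_moment d0 lambda0 PhiP r0.
have lV : cell_vol Phi \in Lfun P 1 by apply/Lfun1_integrable.
have lb : ball_cell_vol Phi r \in Lfun P 1 by apply/Lfun1_integrable.
have lbV : (ball_cell_vol Phi r * cell_vol Phi)%R \in Lfun P 1 by apply/Lfun1_integrable.
rewrite /taylor2_cdf covarianceE// -/W EV.
rewrite fineB ?fineM ?fin_numM ?expectation_fin_num//.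
rewrite mean_product// mean_ball_cell//=.
by field; exact: lt0r_neq0.
Qed.

End Expansion.

Theorem theorem3 (R : realType) (d : nat) (disp : measure_display)
    (Omega : measurableType disp) (P : probability Omega R) (lambda : R)
    (Phi : Omega -> set 'rV[R]_d) (rho : R)
    (d_gt0 : (0 < d)%N) (lambda_gt0 : 0 < lambda)
    (PhiP : poisson_point_process P lambda Phi) :
  (exists l : R,
      nth_derivative_at0 d
        (fun r => 1 - expR (- (rho * lambda * kappa d * r ^+ d))) l
      /\ nth_derivative_at0 d (taylor2_cdf P Phi) l)
  <->
  rho = 1 + fine 'V_P[cell_vol Phi] / fine 'E_P[cell_vol Phi] ^+ 2.
Proof.
case: d Phi d_gt0 PhiP => // m Phi d_gt0 PhiP.
have [_ ->] := cell_vol_moment d_gt0 lambda_gt0 PhiP.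
set W := fine 'V_P[cell_vol Phi].
have hexp := nth_derivative_at0_expR m (rho * lambda * kappa m.+1).
have htay : nth_derivative_at0 m.+1 (taylor2_cdf P Phi)
    (m.+1`!%:R * (kappa m.+1 * lambda * (1 + lambda ^+ 2 * W))).
  pose phi t := (2 * lambda + lambda ^+ 3 * W) * mean_remainder (lambda := lambda) (d := m.+1) t +
    (- lambda ^+ 2) * product_remainder (lambda := lambda) (d := m.+1) t.
  apply: (@nth_derivative_at0_flat _ m _ (fun r => phi (r ^+ m.+1))).
    apply: (flat_exprn d_gt0); apply: flatD; apply: flatZ.
      exact: flat_mean_remainder.
    exact: flat_product_remainder.
  by move=> r r0; exact: taylor2_expansion.
have k0 := lt0r_neq0 (@kappa_gt0 R m.+1).
have l0 := lt0r_neq0 lambda_gt0.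
have f0 : m.+1`!%:R != 0 :> R by rewrite pnatr_eq0 gtn_eqF// fact_gt0.
have rhoE : rho = 1 + lambda ^+ 2 * W <-> rho * lambda * kappa m.+1 =
    kappa m.+1 * lambda * (1 + lambda ^+ 2 * W).
  split => [->|h]; first by ring.
  apply: (mulfI (mulf_neq0 k0 l0)); rewrite -h; ring.
have -> : 1 + W / fine (lambda^-1)%:E ^+ 2 = 1 + lambda ^+ 2 * W.
  by rewrite /=; field.
split => [[l [h1 h2]]|/rhoE h].
  apply/rhoE/(mulfI f0).
  by rewrite -(nth_derivative_at0_inj h1 hexp) (nth_derivative_at0_inj h2 htay).
by exists (m.+1`!%:R * (rho * lambda * kappa m.+1)); split; [|rewrite h].
Qed.
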